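(* Let $\phi:[0,\infty)\to[0,\infty)$, $F,F_1:(0,\infty)\times\mathbb{R}\to(0,\infty)$, let $p,q\in\mathcal{P}(\mathbb{R})$ satisfy $1/p(x)+1/q(x)=1$, and let $(R(t))_{t>0}\subseteq L(X,Y)$ be a strongly continuous operator family. Let $g:\mathbb{R}\to X$ be such that $\check g$ is measurable and $\int_{-x}^\infty\|R(v+x)\|\,\|\check g(v)\|\,dv<\infty$ for every $x\in\mathbb{R}$. Suppose that for all $l>0$ and $x\in\mathbb{R}$ $$\Sigma(l,x):=\sum_{k=0}^\infty\bigl\|R(v+x)\bigr\|_{L^{q(v)}[-x+kl,-x+(k+1)l]}\,F(l,-x+kl)^{-1}<\infty .$$ For $t\in\mathbb{R}$ and $l,\epsilon>0$ consider the condition $( * )$ there exist $a>0$ and $\lambda>0$ such that $\lambda\le a$, $[0,a]\subseteq F_1(l,t)^{-1}\phi^{-1}\bigl([0,\epsilon]\bigr)$ and $$\int_t^{t+l}\varphi_{p(x)}\Bigl(\frac{2\,\Sigma(l,x)\,\sup\phi^{-1}([0,\epsilon])}{\lambda}\Bigr)\,dx\le1 .$$ (a) If $\check g$ is equi-Weyl-$(p,\phi,F)_2$-almost periodic and $( * )$ holds for every $t\in\mathbb{R}$ and $l,\epsilon>0$, then $G:\mathbb{R}\to Y$, $G(x):=\int_{-\infty}^xR(x-s)g(s)\,ds$, is well-defined and equi-Weyl-$(p,\phi,F_1)_2$-almost periodic. (b) If $\check g$ is Weyl-$(p,\phi,F)_2$-almost periodic and there exists $l_0>0$ such that $( * )$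 holds for all $l\ge l_0$, $\epsilon>0$ and $t\in\mathbb{R}$, then $G$ is well-defined and Weyl-$(p,\phi,F_1)_2$-almost periodic.
   Context: $X,Y$ are complex Banach spaces; $L(X,Y)$ is the space of bounded linear operators from $X$ to $Y$; $\check g(t):=g(-t)$; $\phi^{-1}(A)$ denotes the preimage of $A$ under $\phi$, and $cA=\{ca:a\in A\}$. For $\Omega\subseteq\mathbb{R}$, $\mathcal{P}(\Omega)$ is the set of Lebesgue measurable $p:\Omega\to[1,\infty]$ (with $1/\infty=0$). For $t\ge 0$: $\varphi_{p(x)}(t)=t^{p(x)}$ if $p(x)<\infty$; if $p(x)=\infty$, $\varphi_{p(x)}(t)=0$ for $0\le t\le 1$ and $\varphi_{p(x)}(t)=\infty$ for $t>1$. A measurable $u$ on $\Omega$ belongs to $L^{p(x)}(\Omega)$ iff $\int_\Omega\varphi_{p(x)}(\lambda\|u(x)\|)dx<\infty$ for some $\lambda>0$, and $\|u\|_{L^{p(\cdot)}(\Omega)}=\inf\{\lambda>0:\int_\Omega\varphi_{p(x)}(\|u(x)\|/\lambda)\,dx\le 1\}$. On subintervals the restriction of $p$ is used; in $\|R(v+x)\|_{L^{q(v)}[a,b]}$ the variable is $v$ and the $L^{q(v)}$-norm of the operator norm $v\mapsto\|R(v+x)\|_{L(X,Y)}$ is meant. Let $p\in\mathcal{P}(\mathbb{R})$, $\phi:[0,\infty)\to[0,\infty)$, $F:(0,\infty)\times\mathbb{R}\to(0,\infty)$, let $Z$ be a Banach space, and let $f:\mathbb{R}\to Z$ be such that $\|f(\cdot+\tau)-f(\cdot)\|\in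 L^{p(x)}(K)$ for every $\tau\in\mathbb{R}$ and compact $K\subseteq\mathbb{R}$. Then $f$ is: - equi-Weyl-$(p,\phi,F)_2$-almost periodic iff for each $\epsilon>0$ there are $l>0$, $L>0$ such that every interval $I'\subseteq\mathbb{R}$ of length $L$ contains $\tau$ with $\sup_{t\in\mathbb{R}}\phi\bigl(F(l,t)\,\|f(\cdot+\tau)-f(\cdot)\|_{L^{p(\cdot)}[t,t+l]}\bigr)\le\epsilon$; - Weyl-$(p,\phi,F)_2$-almost periodic iff for each $\epsilon>0$ there is $L>0$ such that every interval $I'\subseteq\mathbb{R}$ of length $L$ contains $\tau$ with $\limsup_{l\to\infty}\sup_{t\in\mathbb{R}}\phi\bigl(F(l,t)\,\|f(\cdot+\tau)-f(\cdot)\|_{L^{p(\cdot)}[t,t+l]}\bigr)\le\epsilon$.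
   Formalization: For G, the condition that ‖G(·+τ)−G‖ lies in L^{p(x)}(K) for compact K is proved only for the almost periods τ found, not for every real τ: for other τ it can fail under the stated hypotheses. If it holds for all τ, G is almost periodic exactly as defined. *)

(* Defs.v *)
(* Complex Banach spaces are [completeNormedModType R[i]],
   where [R : realType] is the field of real numbers. *)
From HB Require Import structures.
From mathcomp Require Import all_boot all_order all_algebra.
From mathcomp Require Import all_classical all_reals all_analysis measurable_realfun.
From mathcomp Require Import complex.
Import Order.TTheory GRing.Theory Num.Theory numFieldNormedType.Exports.

Set Implicit Arguments.
Unset Strict Implicit.
Unset Printing Implicit Defensive.

Local Open Scope classical_set_scope.
Local Open Scope ring_scope.
Local Open Scope complex_scope.

Section LebesgueIntegral.
Variable R : realType.

(* The real line with the sigma-algebra of Lebesgue (not only Borel) measurable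
   sets: the carrier of [completed_lebesgue_measure], convertible to [R]. *)
Definition lebesgueR := caratheodory_type (wlength (@idfun R))^*%mu.

Definition leb : {measure set lebesgueR -> \bar R} :=
  @completed_lebesgue_measure R.

Definition leb_measurable_set (A : set R) : Prop :=
  measurable (A : set lebesgueR).

Definition leb_measurable (D : set R) (f : R -> \bar R) : Prop :=
  measurable_fun (D : set lebesgueR) (f : lebesgueR -> \bar R).

Definition leb_int (D : set R) (f : R -> \bar R) : \bar R :=
  (\int[leb]_(x in (D : set lebesgueR)) (f : lebesgueR -> \bar R) x)%E.

Definition leb_ae (P : R -> Prop) : Prop :=
  {ae leb, forall x : lebesgueR, P x}.

End LebesgueIntegral.

Section Operators.
Variable R : realType.

(* The norm of a normed space over R[i] takes values in R[i]; it is real. *)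
Definition rnorm (V : normedModType R[i]) (x : V) : R := complex.Re `|x|.

Definition bounded_op (X Y : normedModType R[i]) (T : {linear X -> Y}) : Prop :=
  exists M : R, forall x, rnorm (T x) <= M * rnorm x.

Definition opnorm (X Y : normedModType R[i]) (T : {linear X -> Y}) : R :=
  sup [set rnorm (T x) | x in [set x : X | rnorm x <= 1]].

End Operators.

Section Bochner.
Variables (R : realType) (V : completeNormedModType R[i]).

Definition simple_fun (s : R -> V) : Prop :=
  finite_set (range s) /\ forall v, leb_measurable_set (s @^-1` [set v]).

Definition integrable_simple_fun (D : set R) (s : R -> V) : Prop :=
  simple_fun s /\ forall v, v != 0 -> (leb R (D `&` s @^-1` [set v]) < +oo)%E.

(* The value 0 may be taken on a set of infinite measure; it contributes 0. *)
Definition simple_integral (D : set R) (s : R -> V) : V :=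
  \sum_(v \in range s) (fine (leb R (D `&` s @^-1` [set v])))%:C *: v.

Definition strongly_measurable (D : set R) (f : R -> V) : Prop :=
  exists s : nat -> R -> V, (forall n, simple_fun (s n)) /\
    leb_ae (fun x => D x -> (fun n => s n x) @ \oo --> f x).

Definition bochner_approx (D : set R) (f : R -> V) (s : nat -> R -> V) : Prop :=
  [/\ forall n, integrable_simple_fun D (s n),
      leb_ae (fun x => D x -> (fun n => s n x) @ \oo --> f x)
    & (fun n => leb_int D (fun x => (rnorm (f x - s n x))%:E)) @ \oo --> 0%E].

Definition bochner_integrable (D : set R) (f : R -> V) : Prop :=
  exists s, bochner_approx D f s.

Definition is_bochner_integral (D : set R) (f : R -> V) (v : V) : Prop :=
  exists s, bochner_approx D f s /\
    (fun n => simple_integral D (s n)) @ \oo --> v.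

(* 0 when [f] is not Bochner integrable on [D] *)
Definition bochner (D : set R) (f : R -> V) : V :=
  xget 0 [set v | is_bochner_integral D f v].

End Bochner.

Section VariableExponent.
Variable R : realType.
Implicit Types (p : R -> \bar R) (D : set R) (u : R -> R).

Definition exponent p : Prop :=
  leb_measurable setT p /\ forall x, (1 <= p x)%E.

(* phi_p(t) for p in [1, +oo] and t in [0, +oo], with phi_p(+oo) = +oo *)
Definition varphi (p t : \bar R) : \bar R :=
  if p == +oo%E then (if (t <= 1)%E then 0%E else +oo%E)
  else poweR t (fine p).

Definition in_Lp p D u : Prop :=
  leb_measurable D (fun x => (u x)%:E) /\
  exists2 lam : R, 0 < lam &
    (leb_int D (fun x => varphi (p x) (lam * u x)%:E) < +oo)%E.

(* Luxemburg norm; +oo when [u] is not in L^p(D) *)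
Definition Lp_norm p D u : \bar R :=
  ereal_inf [set lam%:E | lam in [set lam : R | 0 < lam /\
    (leb_int D (fun x => varphi (p x) (u x / lam)%:E) <= 1)%E]].

End VariableExponent.

Section WeylAlmostPeriodic.
Variables (R : realType) (Z : completeNormedModType R[i]).
Implicit Types (p : R -> \bar R) (phi : R -> R) (F : R -> R -> R) (f : R -> Z).

Definition diff_norm f (tau x : R) : R := rnorm (f (x + tau) - f x).

Definition diff_Lploc p f (tau : R) : Prop :=
  forall K : set R, compact K -> in_Lp p K (diff_norm f tau).

(* sup over t of phi(F(l,t) ||f(. + tau) - f||_{L^p[t,t+l]}).  It is only used
   for tau with [diff_Lploc p f tau], so that the norm is finite. *)
Definition Weyl_sup p phi F f (tau l : R) : \bar R :=
  ereal_sup [set (phi (F l t *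
    fine (Lp_norm p `[t, t + l] (diff_norm f tau))))%:E | t in [set: R]].

(* The booleans range over the open, half-open and closed intervals with
   endpoints a and a + L. *)
Definition meets_intervals_of_length (L : R) (P : R -> Prop) : Prop :=
  forall (b b' : bool) (a : R), exists2 tau,
    tau \in Interval (BSide b a) (BSide b' (a + L)) & P tau.

(* The translations [tau] that occur are themselves required to satisfy
   [diff_Lploc p f tau].  This is automatic under the usual standing assumption
   [forall tau, diff_Lploc p f tau], and makes the notions meaningful for [f]
   for which that assumption is not known. *)
Definition equi_Weyl_ap p phi F f : Prop :=
  forall eps : R, 0 < eps -> exists l L : R, [/\ 0 < l, 0 < L &
    meets_intervals_of_length L (fun tau => diff_Lploc p f tau /\
      (Weyl_sup p phi F f tau l <= eps%:E)%E)].

Definition Weyl_ap p phi F f : Prop :=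
  forall eps : R, 0 < eps -> exists2 L : R, 0 < L &
    meets_intervals_of_length L (fun tau => diff_Lploc p f tau /\
      (limf_esup (Weyl_sup p phi F f tau) (pinfty_nbhs R) <= eps%:E)%E).

End WeylAlmostPeriodic.

Section Convolution.
Variables (R : realType) (X Y : completeNormedModType R[i]).
Implicit Types (T : R -> {linear X -> Y}) (g : R -> X).
Implicit Types (p q : R -> \bar R) (phi : R -> R) (F : R -> R -> R).

Definition reflect_fun g : R -> X := fun t => g (- t).

(* Only the operators [T t] with 0 < t matter. *)
Definition strongly_continuous T : Prop :=
  (forall t, 0 < t -> bounded_op (T t)) /\
  (forall (x : X) (t : R), 0 < t -> {for t, continuous (fun s => T s x)}).

Definition convolution_integrable T g : Prop :=
  forall x : R,
    bochner_integrable `]-oo, x[ (fun s => T (x - s) (g s)).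

Definition convolution T g : R -> Y :=
  fun x => bochner `]-oo, x[ (fun s => T (x - s) (g s)).

Definition Sigma T q F (l x : R) : \bar R :=
  (\sum_(0 <= k <oo)
    Lp_norm q `[(- x + k%:R * l)%R, (- x + k.+1%:R * l)%R]
      (fun v => opnorm (T (v + x)%R)) * ((F l (- x + k%:R * l))^-1)%:E)%E.

(* phi : [0, +oo) -> [0, +oo) is represented by a function on R, of which only
   the restriction to [0, +oo) is used. *)
Definition phi_preimage phi (eps : R) : set R :=
  [set y | 0 <= y /\ 0 <= phi y <= eps].

(* The supremum is taken in [0, +oo], with 0 * +oo = 0.  F is arbitrary, so
   that Sigma T q F l need not be measurable in x; the integral is then the
   lower one. *)
Definition Weyl_condition T p q phi F F1 (t l eps : R) : Prop :=
  exists a lam : R, [/\ 0 < a, 0 < lam, lam <= a,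
    `[0, a]%classic `<=` [set (F1 l t)^-1 * y | y in phi_preimage phi eps]
  & (leb_int `[t, (t + l)%R] (fun x => varphi (p x)
      (2%:E * Sigma T q F l x *
        ereal_sup [set y%:E | y in phi_preimage phi eps] * (lam^-1)%:E))
      <= 1)%E].

End Convolution.

(* Main.v *)
Require Import Defs.
From HB Require Import structures.
From mathcomp Require Import all_boot all_order all_algebra.
From mathcomp Require Import all_classical all_reals all_analysis measurable_realfun.
From mathcomp Require Import complex.
From mathcomp Require Import lra ring.
Import Order.TTheory GRing.Theory Num.Theory numFieldNormedType.Exports.
Local Open Scope classical_set_scope.
Local Open Scope ring_scope.

(** Why the theorem holds.  Write G for the convolution and h for the reflection
    of g.  After a reflection, G(x + tau) and G(x) are integrals over the same ray
    ]-x, +oo[ of T(v + x) applied to h(v - tau) and to h(v), so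
      |G(x + tau) - G(x)| <= int_{-x}^{oo} ||T(v + x)|| |h(v - tau) - h(v)| dv
    ([convolution_diff_le]).  Cut the ray into intervals of length l.  On each of
    them the Hoelder inequality for variable exponents ([Lp_holder], with constant
    2) splits off the L^q norm of the operators, which is summed by Sigma, from the
    weighted L^p norm of the difference of h.  If -tau is an eps-period of h, the
    weighted norm lies in the preimage of [0, eps] under phi, hence below its
    supremum S.  This proves |G(x + tau) - G(x)| <= 2 Sigma(l, x) S
    ([convolution_diff_le_Sigma]).  The integral inequality assumed on Sigma then
    says that the L^p norm of G(. + tau) - G over [t, t + l] is at most lam <= a,
    and the inclusion assumed for [0, a] that phi of the weighted norm is at most
    eps ([convolution_transfer]).  Hence tau is an eps-period of G with the same l.
    In the equi-Weyl case this is the claim; in the Weyl case it is applied to all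
    large l, with eps / 2 for h so that the upper limit becomes an eventual bound.

    Two points need more than estimates.  The integrals are Bochner integrals
    defined by approximating simple functions, and only a small part of their theory
    is developed: the approximation of a strongly measurable function by
    nearest points of a countable set ([dominated_approxP]), and the inequality
    |int f - int h| <= int |f - h| ([bochner_dist_le]), from which uniqueness and
    dominated convergence follow.  Secondly, |G(. + tau) - G| has to be measurable
    although G is in general discontinuous.  The function G is the pointwise limit of
    the convolutions of truncated operators with bounded functions of bounded
    support, and these are continuous by dominated convergence
    ([convolution_diff_measurable]). *)

Set Implicit Arguments.
Unset Strict Implicit.
Unset Printing Implicit Defensive.

(** * Lebesgue measurability, null sets and reflections of the line *)

Section LebesgueReflection.
Variable R : realType.
Local Notation mu := (leb R).

Lemma leb_measurable_borel (A : set R) :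
  measurable A -> leb_measurable_set A.
Proof. exact: sub_caratheodory. Qed.

Lemma lebE (A : set R) : mu A = lebesgue_measure A.
Proof. by []. Qed.

Lemma leb_measurable_itv (i : interval R) : leb_measurable_set [set` i].
Proof. by apply: leb_measurable_borel; exact: measurable_itv. Qed.

Lemma leb_measurable_open (A : set R) : open A -> leb_measurable_set A.
Proof. by move=> oA; apply: leb_measurable_borel; exact: open_measurable. Qed.

Definition flip (c s : R) : R := c - s.

Lemma flipK c : involutive (flip c).
Proof. by move=> s; rewrite /flip opprB addrC subrK. Qed.

Lemma flip_measurable c : measurable_fun [set: R] (flip c).
Proof.
apply: continuous_measurable_fun => x; apply: cvgB; [exact: cvg_cst|exact: cvg_id].
Qed.

Lemma lebesgue_measure_flip c (A : set R) : measurable A ->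
  lebesgue_measure (flip c @^-1` A) = lebesgue_measure A.
Proof.
move=> mA.
have mf : measurable_fun setT (flip c : measurableTypeR R -> measurableTypeR R).
  exact: flip_measurable.
rewrite -[LHS]/(pushforward lebesgue_measure (flip c : _ -> measurableTypeR R) A).
apply/esym/lebesgue_measure_unique => //= _ [[a b]] _ <-.
rewrite /pushforward.
have -> : flip c @^-1` [set` `]a, b]] = `[c - b, c - a[%classic.
  apply/seteqP; split=> x /=; rewrite /flip !in_itv/= => /andP[h1 h2]; apply/andP; split; lra.
rewrite !lebesgue_measure_itv/= !lte_fin.
have -> : (c - b < c - a) = (a < b) by apply/idP/idP; lra.
by case: ifP => //; rewrite -!EFinD => _; congr (_ %:E); lra.
Qed.

Lemma leb_split (A : set R) : leb_measurable_set A ->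
  exists B Z : set R, [/\ measurable B, measurable Z, lebesgue_measure Z = 0%E,
     B `<=` A & A `<=` B `|` Z].
Proof.
rewrite /leb_measurable_set.
have -> : measurable (A : set (lebesgueR R)) =
  (completed_algebra_gen (@lebesgue_measure R)).-sigma.-measurable A.
  by rewrite completed_caratheodory_measurable.
rewrite g_sigma_completed_algebra_genE => -[B mB [N [Z [mZ Z0 NZ]]] <-].
exists B, Z; split=> //.
by move=> x [|/NZ]; [left|right].
Qed.

(** Completeness of the measure: a set squeezed between a Borel set and the same
    set enlarged by a null set is measurable. *)
Lemma leb_measurable_between (A B Z : set R) : measurable B -> measurable Z ->
  lebesgue_measure Z = 0%E -> B `<=` A -> A `<=` B `|` Z ->
  leb_measurable_set A /\ mu A = lebesgue_measure B.
Proof.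
move=> mB mZ Z0 BA AZ.
have mA : leb_measurable_set A.
  have -> : A = B `|` (A `\` B) by rewrite setDUK.
  apply: measurableU; first exact: leb_measurable_borel.
  apply: completed_lebesgue_measure_is_complete.
  exists Z; split=> //; first exact: leb_measurable_borel.
  by move=> x [/AZ[]].
split=> //; apply/eqP; rewrite eq_le; apply/andP; split; last first.
  by rewrite -lebE; apply: le_measure => //; rewrite inE//; exact: leb_measurable_borel.
have mB' := leb_measurable_borel mB; have mZ' := leb_measurable_borel mZ.
apply: (@le_trans _ _ (mu (B `|` Z))).
  by apply: le_measure => //; rewrite inE//; exact: measurableU.
apply: (le_trans (measureU2 _ _ _)) => //.
rewrite -[leRHS]adde0 leeD // -[leRHS]Z0 //.
Qed.

(** A Lebesgue measurable set is Borel only up to a null set; reflection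
    invariance, known for Borel sets by uniqueness of Lebesgue measure, has to
    be carried through that decomposition. *)
Lemma leb_flip c (A : set R) : leb_measurable_set A ->
  leb_measurable_set (flip c @^-1` A) /\ mu (flip c @^-1` A) = mu A.
Proof.
move=> /[dup] mA /leb_split[B [Z [mB mZ Z0 BA AZ]]].
have mr (X : set R) : measurable X -> measurable (flip c @^-1` X).
  by move=> mX; rewrite -[_ @^-1` _]setTI; exact: flip_measurable.
have [? ->] := @leb_measurable_between (flip c @^-1` A) (flip c @^-1` B)
  (flip c @^-1` Z) (mr _ mB) (mr _ mZ)
  (etrans (lebesgue_measure_flip c mZ) Z0) (fun x => @BA _) (fun x => @AZ _).
split=> //; rewrite lebesgue_measure_flip//.
by have [_ ->] := leb_measurable_between mB mZ Z0 BA AZ.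
Qed.

Lemma leb_ae_flip c (P : R -> Prop) : leb_ae P -> leb_ae (P \o flip c).
Proof.
move=> [A [mA A0 PA]]; have [mA' A'] := leb_flip c mA.
exists (flip c @^-1` A); split=> //; first by rewrite [LHS]A'.
by move=> x /= nP; apply: PA.
Qed.

Lemma leb_measurable_flip c (D : set R) (f : R -> \bar R) :
  leb_measurable D f -> leb_measurable (flip c @^-1` D) (f \o flip c).
Proof.
move=> mf mD B mB.
rewrite -[X in measurable X]/(flip c @^-1` (D `&` f @^-1` B)).
apply: (leb_flip c _).1.
apply: mf => //.
have -> : D = flip c @^-1` (flip c @^-1` D).
  by apply/seteqP; split=> x /=; rewrite flipK.
exact: (leb_flip c _).1.
Qed.

Lemma leb_int_flip c (D : set R) (f : R -> \bar R) :
  leb_measurable_set D -> leb_measurable D f ->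
  (forall x, D x -> (0 <= f x)%E) ->
  leb_int D f = leb_int (flip c @^-1` D) (f \o flip c).
Proof.
move=> mD mf f0.
have mr : measurable_fun setT (flip c : lebesgueR R -> lebesgueR R).
  by move=> _ A mA; rewrite setTI; exact: (leb_flip c mA).1.
rewrite /leb_int -(ge0_integral_pushforward mr) //; last first.
  by move=> x; rewrite inE; exact: f0.
apply: eq_measure_integral => A mA _.
by rewrite /pushforward; exact/esym/(leb_flip c mA).2.
Qed.

Lemma leb_aeW (P : R -> Prop) : (forall x, P x) -> leb_ae P.
Proof. by move=> h; exact: (@aeW _ (lebesgueR R) R mu P h). Qed.

Lemma leb_aeS (P Q : R -> Prop) : (forall x, P x -> Q x) -> leb_ae P -> leb_ae Q.
Proof. by move=> PQ; exact: (@filterS _ _ (ae_filter_ringOfSetsType mu)). Qed.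

Lemma leb_aeI (P Q : R -> Prop) : leb_ae P -> leb_ae Q -> leb_ae (fun x => P x /\ Q x).
Proof. exact: (@filterI _ _ (ae_filter_ringOfSetsType mu)). Qed.

Lemma leb_ae_forall (P : nat -> R -> Prop) :
  (forall n, leb_ae (P n)) -> leb_ae (fun x => forall n, P n x).
Proof. exact: ae_foralln. Qed.

Lemma leb_measurable_ext (D : set R) (f g : R -> \bar R) :
  (forall x, D x -> f x = g x) -> leb_measurable D f -> leb_measurable D g.
Proof. by move=> fg; apply: eq_measurable_fun => x; rewrite inE; exact: fg. Qed.

Lemma leb_measurable_ae (D : set R) (f g : R -> \bar R) :
  leb_ae (fun x => D x -> f x = g x) -> leb_measurable D f -> leb_measurable D g.
Proof.
by apply: ae_measurable_fun; exact: completed_lebesgue_measure_is_complete.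
Qed.

(** The pointwise upper limit is measurable everywhere and agrees with the limit
    almost everywhere, which suffices because the measure is complete. *)
Lemma leb_measurable_cvg (D : set R) (f_ : nat -> R -> \bar R) (f : R -> \bar R) :
  (forall n, leb_measurable D (f_ n)) ->
  leb_ae (fun x => D x -> f_ n x @[n --> \oo] --> f x) ->
  leb_measurable D f.
Proof.
move=> mf cf; apply: (@leb_measurable_ae _ (fun x => limn_esup (f_^~ x))).
  apply: leb_aeS cf => x /[apply] cf.
  by rewrite limn_esup_lim; have /cvg_lim <-// := @cvg_esups _ (f_^~ x) (f x) cf.
exact: measurable_fun_limn_esup.
Qed.

Lemma leb_measurableS (D E : set R) (f : R -> \bar R) :
  leb_measurable_set E -> D `<=` E -> leb_measurable E f -> leb_measurable D f.
Proof. by move=> mE DE; exact: measurable_funS. Qed.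

(** The integral of a nonnegative function is a supremum over the simple
    functions below it, so monotonicity holds for nonmeasurable functions as
    well. The integrand involving Sigma, which may be nonmeasurable, is reached
    this way. *)
Lemma leb_int_mono (D : set R) (f g : R -> \bar R) :
  (forall x, D x -> (0 <= f x)%E) -> (forall x, D x -> (f x <= g x)%E) ->
  (leb_int D f <= leb_int D g)%E.
Proof.
move=> f0 fg; rewrite /leb_int ge0_integralE//; last first.
rewrite ge0_integralE//; last by move=> x Dx; exact: le_trans (f0 _ Dx) (fg _ Dx).
apply: le_ereal_sup => _ [h hf <-]; exists h => // x.
by apply: (le_trans (hf x)); apply: lee_restrict.
Qed.

Lemma leb_int_ge0 (D : set R) (f : R -> \bar R) :
  (forall x, D x -> (0 <= f x)%E) -> (0 <= leb_int D f)%E.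
Proof. by move=> f0; apply: (@integral_ge0 _ (lebesgueR R) R mu). Qed.

Lemma leb_int_subset (A D : set R) (f : R -> \bar R) :
  (forall x, D x -> (0 <= f x)%E) -> A `<=` D -> (leb_int A f <= leb_int D f)%E.
Proof.
move=> f0 AD; rewrite /leb_int (@integral_mkcond _ (lebesgueR R) R mu A)
  (@integral_mkcond _ (lebesgueR R) R mu D).
apply: leb_int_mono => x _; rewrite !patchE.
  by case: ifP => //; rewrite inE => /AD /f0.
case: ifPn => xA; first by rewrite mem_set//; apply: AD; rewrite inE in xA.
by case: ifP => //; rewrite inE => /f0.
Qed.

Lemma leb_int_ext (D : set R) (f g : R -> \bar R) :
  (forall x, D x -> f x = g x) -> leb_int D f = leb_int D g.
Proof. by move=> fg; apply: (@eq_integral _ (lebesgueR R) R mu) => x; rewrite inE; exact: fg. Qed.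

Lemma leb_intD (D : set R) (f g : R -> \bar R) :
  leb_measurable_set D -> leb_measurable D f -> leb_measurable D g ->
  (forall x, D x -> (0 <= f x)%E) -> (forall x, D x -> (0 <= g x)%E) ->
  leb_int D (fun x => f x + g x)%E = (leb_int D f + leb_int D g)%E.
Proof. by move=> *; apply: (@ge0_integralD _ (lebesgueR R) R mu). Qed.

Lemma leb_intZl (D : set R) (c : R) (f : R -> \bar R) :
  leb_measurable_set D -> leb_measurable D f -> (forall x, D x -> (0 <= f x)%E) ->
  0 <= c -> leb_int D (fun x => c%:E * f x)%E = (c%:E * leb_int D f)%E.
Proof.
move=> mD mf f0 c0.
exact: (@ge0_integralZl_EFin _ (lebesgueR R) R mu D mD f f0 mf c c0).
Qed.

Lemma leb_measurable_if (D : set R) (b : R -> bool) (f h : R -> \bar R) :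
  leb_measurable_set D -> leb_measurable_set (D `&` [set x | b x]) ->
  leb_measurable D f -> leb_measurable D h ->
  leb_measurable D (fun x => if b x then f x else h x).
Proof.
move=> mD mb mf mh.
have mb' : measurable_fun (D : set (lebesgueR R)) (b : lebesgueR R -> bool).
  apply: (measurable_fun_bool true).
  rewrite (_ : D `&` _ = D `&` [set x | b x]); first exact: mb.
  by apply/seteqP; split=> x [].
apply: (@measurable_fun_if _ _ (lebesgueR R) _ f h D mD b mb').
  by apply: (measurable_funS mD _ mf) => x [].
by apply: (measurable_funS mD _ mh) => x [].
Qed.

End LebesgueReflection.

(** * Real-valued norms in complex normed spaces *)

Section Rnorm.
Variables (R : realType) (V : normedModType R[i]).
Implicit Types (u v w : V).

(** Through this identity all estimates are carried out with real numbers; the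
    norm itself takes values in the complex field, which is only partially
    ordered. *)
Lemma normrE v : `|v| = ((rnorm v)%:C)%C.
Proof.
have := normr_ge0 v; rewrite /rnorm; case: (`|v|) => a b.
by rewrite lecE /= => /andP[/eqP -> _].
Qed.

Lemma rnorm_ge0 v : 0 <= rnorm v.
Proof. by have := normr_ge0 v; rewrite normrE lecR. Qed.

Lemma rnormD u v : rnorm (u + v) <= rnorm u + rnorm v.
Proof. by have := ler_normD u v; rewrite !normrE -rmorphD lecR. Qed.

Lemma rnormN v : rnorm (- v) = rnorm v.
Proof. by rewrite /rnorm normrN. Qed.

Lemma rnormBC u v : rnorm (u - v) = rnorm (v - u).
Proof. by rewrite -rnormN opprB. Qed.

Lemma rnorm0 : rnorm (0 : V) = 0.
Proof. by rewrite /rnorm normr0. Qed.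

Lemma rnorm_eq0 v : (rnorm v == 0) = (v == 0).
Proof.
by apply/eqP/eqP => [v0|->]; [apply/normr0_eq0; rewrite normrE v0|exact: rnorm0].
Qed.

Lemma rnormZ (a : R) v : rnorm ((a%:C)%C *: v) = `|a| * rnorm v.
Proof.
apply: (@complexI R); rewrite -normrE normrZ rmorphM normrE.
by congr (_ * _); rewrite normc_def /= expr0n addr0 sqrtr_sqr.
Qed.

Lemma rnorm_triangle w u v : rnorm (u - v) <= rnorm (u - w) + rnorm (w - v).
Proof. by apply: le_trans (rnormD _ _); rewrite addrA subrK. Qed.

Lemma rnorm_sub_le u v : rnorm u - rnorm v <= rnorm (u - v).
Proof. by rewrite lerBlDr; apply: le_trans (rnormD _ _); rewrite subrK. Qed.

Lemma rnorm_dist_dist u v : `|rnorm u - rnorm v| <= rnorm (u - v).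
Proof. by rewrite ler_norml lerNl opprB {1}rnormBC !rnorm_sub_le. Qed.

Lemma rnorm_sum I (r : seq I) (F : I -> V) :
  rnorm (\sum_(i <- r) F i) <= \sum_(i <- r) rnorm (F i).
Proof.
elim/big_ind2 : _ => //; first by rewrite rnorm0.
by move=> x a y b xa yb; apply: (le_trans (rnormD _ _)); exact: lerD.
Qed.

Lemma cvg_rnormP (T : Type) (F : set_system T) (FF : Filter F) (f : T -> V) v :
  f t @[t --> F] --> v <-> rnorm (f t - v) @[t --> F] --> (0 : R).
Proof.
split=> [/cvgrPdist_lt fv|/cvgrPdist_lt fv].
- apply/cvgrPdist_lt => e e0.
  have : 0 < (e%:C)%C by rewrite ltcR.
  move=> /fv; apply: filterS => t.
  by rewrite sub0r normrN ger0_norm ?rnorm_ge0// normrE ltcR rnormBC.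
- apply/cvgrPdist_lt => -[a b]; rewrite ltcE /= => /andP[/eqP -> a0].
  move: (fv _ a0); apply: filterS => t.
  by rewrite sub0r normrN ger0_norm ?rnorm_ge0// rnormBC normrE => h; rewrite ltcE /= eqxx.
Qed.

Lemma cvg_rnorm (T : Type) (F : set_system T) (FF : Filter F) (f : T -> V) v :
  f t @[t --> F] --> v -> rnorm (f t) @[t --> F] --> rnorm v.
Proof.
move=> /cvg_rnormP /cvgrPdist_lt fv; apply/cvgrPdist_lt => e e0.
move: (fv _ e0); apply: filterS => t; apply: le_lt_trans.
rewrite sub0r normrN [leRHS]ger0_norm ?rnorm_ge0// rnormBC.
exact: rnorm_dist_dist.
Qed.

Lemma cvg_rnorm_squeeze (T : Type) (F : set_system T) (FF : Filter F) (f : T -> V) v (h : T -> R) :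
  (forall t, rnorm (f t - v) <= h t) -> h t @[t --> F] --> (0 : R) ->
  f t @[t --> F] --> v.
Proof.
move=> fh h0; apply/cvg_rnormP; apply: (squeeze_cvgr _ (cvg_cst 0) h0).
by apply: nearW => t; rewrite rnorm_ge0 fh.
Qed.

End Rnorm.

Lemma rnorm_cauchy (R : realType) (V : completeNormedModType R[i]) (u : nat -> V) :
  (forall e : R, 0 < e -> \forall N \near \oo, forall m n, (N <= m)%N -> (N <= n)%N ->
     rnorm (u m - u n) < e) ->
  exists v : V, u n @[n --> \oo] --> v.
Proof.
move=> h; suff cu : cvg (u @ \oo) by exists (lim (u @ \oo)).
apply/cauchy_cvgP; apply/cauchy_ballP => -[a b].
rewrite ltcE /= => /andP[/eqP -> a0].
have [N _ hN] := h _ a0.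
exists (u @` [set n | (N <= n)%N], u @` [set n | (N <= n)%N]).
  by split; exists N => // n /= Nn; exists n.
move=> [_ _] [/= [m Nm <-] [n Nn <-]]; rewrite -ball_normE /=.
rewrite normrE ltcE /= eqxx.
exact: (hN N (leqnn N)).
Qed.

(** * Strongly measurable functions *)

Section FiniteValued.
Variable R : realType.

Definition finite_valued (T : Type) (s : R -> T) : Prop :=
  finite_set (range s) /\ forall B, leb_measurable_set (s @^-1` B).

Lemma finite_valued_cst (T : Type) (a : T) : finite_valued (fun=> a).
Proof.
split=> [|B]; first by apply: (sub_finite_set _ (finite_set1 a)) => _ [_ _ <-].
have [aB|aB] := pselect (B a).
  rewrite (_ : _ @^-1` _ = setT); first exact: measurableT.
  by apply/seteqP; split=> x.
rewrite (_ : _ @^-1` _ = set0); first exact: measurable0.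
by apply/seteqP; split=> x.
Qed.

Lemma finite_valued_pair (T U : Type) (s : R -> T) (t : R -> U) :
  finite_valued s -> finite_valued t -> finite_valued (fun x => (s x, t x)).
Proof.
move=> [fs ms] [ft mt].
have frange : finite_set (range (fun x => (s x, t x))).
  apply: (sub_finite_set _ (finite_setX fs ft)).
  by move=> _ [x _ <-]; split; exists x.
split=> // B.
rewrite (_ : _ @^-1` B = \bigcup_(p in range (fun x => (s x, t x)) `&` B)
   (s @^-1` [set p.1] `&` t @^-1` [set p.2])).
  apply: fin_bigcup_measurable => [|p _]; first exact: finite_setIl.
  by apply: measurableI; [exact: ms|exact: mt].
apply/seteqP; split=> [x Bx|x [p [_ Bp] [/= sx tx]]].
  by exists (s x, t x) => //; split=> //; exists x.
by rewrite /= sx tx -surjective_pairing.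
Qed.

Lemma finite_valued_comp (T U : Type) (s : R -> T) (h : T -> U) :
  finite_valued s -> finite_valued (h \o s).
Proof.
move=> [fs ms]; split; last by move=> B; exact: (ms (h @^-1` B)).
rewrite (_ : range _ = h @` range s); first exact: finite_image.
apply/seteqP; split=> [_ [x _ <-]|_ [_ [x _ <-] <-]]; last by exists x.
by exists (s x) => //; exists x.
Qed.

Lemma finite_valued_if (T : Type) (s t : R -> T) (A : set R) :
  leb_measurable_set A -> finite_valued s -> finite_valued t ->
  finite_valued (fun x => if x \in A then s x else t x).
Proof.
move=> mA fs ft.
have fA : finite_valued (fun x => x \in A).
  split=> [|B]; first exact: finite_finset.
  have [tB|tB] := pselect (B true); have [fB|fB] := pselect (B false).
  - rewrite (_ : _ @^-1` _ = setT); first exact: measurableT.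
    by apply/seteqP; split=> x //= _; case: (x \in A).
  - rewrite (_ : _ @^-1` _ = A) //.
    apply/seteqP; split=> x /=; last by move=> Ax; rewrite mem_set.
    by case: (boolP (x \in A)); rewrite ?inE.
  - rewrite (_ : _ @^-1` _ = ~` A); first exact: measurableC.
    apply/seteqP; split=> x /=; last by move=> Ax; rewrite memNset.
    by case: (boolP (x \in A)); rewrite ?inE// notin_setE.
  - rewrite (_ : _ @^-1` _ = set0); first exact: measurable0.
    by apply/seteqP; split=> x //=; case: (x \in A).
exact: (finite_valued_comp (fun p : bool * (T * T) => if p.1 then p.2.1 else p.2.2)
  (finite_valued_pair fA (finite_valued_pair fs ft))).
Qed.

Lemma simple_funP (V : completeNormedModType R[i]) (s : R -> V) :
  simple_fun s <-> finite_valued s.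
Proof.
split=> [[fs ms]|[fs ms]]; last by split.
split=> // B.
rewrite (_ : _ @^-1` B = \bigcup_(v in range s `&` B) (s @^-1` [set v])).
  by apply: fin_bigcup_measurable => [|v _]; [exact: finite_setIl|exact: ms].
apply/seteqP; split=> [x Bx|x [p [_ Bp] /= ->]] //.
by exists (s x) => //; split=> //; exists x.
Qed.

Lemma finite_valued_measurable (T : Type) (s : R -> T) (h : T -> \bar R) (D : set R) :
  finite_valued s -> leb_measurable D (h \o s).
Proof.
move=> [_ ms] mD B mB; apply: measurableI => //.
exact: (ms (h @^-1` B)).
Qed.

Lemma leb_measurable_lt (f g : R -> R) (D : set R) :
  leb_measurable_set D ->
  leb_measurable D (fun x => (f x)%:E) -> leb_measurable D (fun x => (g x)%:E) ->
  leb_measurable_set (D `&` [set x | f x < g x]).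
Proof.
move=> mD /measurable_EFinP mf /measurable_EFinP mg.
have /(_ mD [set true] I) := measurable_fun_ltr mf mg.
by congr (measurable (_ `&` _)); apply/seteqP.
Qed.

End FiniteValued.

Section StronglyMeasurable.
Variables (R : realType) (V : completeNormedModType R[i]).
Implicit Types (f h : R -> V) (D : set R) (y : nat -> V).

(** The approximation nearest f y n x is a point of y 0, ..., y n at minimal
    distance from f x. It has finitely many values, improves with n, and if y 0
    = 0 it stays within |f x| of f x, so the approximations come with a
    dominating function. *)
Fixpoint nearest f y (n : nat) (x : R) : V :=
  if n is m.+1 then
    if x \in [set x | rnorm (f x - y n) < rnorm (f x - nearest f y m x)]
    then y n else nearest f y m x
  else y 0%N.

Lemma nearest_le f y n k x : (k <= n)%N ->
  rnorm (f x - nearest f y n x) <= rnorm (f x - y k).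
Proof.
elim: n => [|n IH]; first by rewrite leqn0 => /eqP ->.
rewrite leq_eqVlt ltnS /= => /orP[/eqP ->|/IH {}IH].
  by case: ifPn; rewrite ?inE // notin_setE /= => /negP; rewrite -leNgt.
by case: ifPn => //; rewrite inE /= => /ltW /le_trans -> //.
Qed.

Lemma nearest_finite_valued f y n :
  (forall k, leb_measurable setT (fun x => (rnorm (f x - y k))%:E)) ->
  finite_valued (nearest f y n) /\
  leb_measurable setT (fun x => (rnorm (f x - nearest f y n x))%:E).
Proof.
move=> mf; elim: n => [|n [IH1 IH2]]; first by split; [exact: finite_valued_cst|exact: mf].
have mA : leb_measurable_set
    [set x | rnorm (f x - y n.+1) < rnorm (f x - nearest f y n x)].
  rewrite -[X in leb_measurable_set X]setTI.
  by apply: leb_measurable_lt; [exact: measurableT|exact: mf|exact: IH2].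
split; first by apply: finite_valued_if => //; exact: finite_valued_cst.

apply: (@leb_measurable_ext R setT (fun x =>
  mine (rnorm (f x - y n.+1))%:E (rnorm (f x - nearest f y n x))%:E)).
  move=> x _ /=; rewrite -EFin_min; congr EFin.
  case: ifPn; rewrite ?inE ?notin_setE /= => h; first by rewrite min_l// ltW.
  by rewrite min_r// leNgt; exact/negP.
by apply: measurable_mine; [exact: mf|exact: IH2].
Qed.

Lemma strongly_measurableP D f : strongly_measurable D f <->
  exists s : nat -> R -> V, (forall n, finite_valued (s n)) /\
    leb_ae (fun x => D x -> s n x @[n --> \oo] --> f x).
Proof.
by split=> -[s [ss sf]]; exists s; split=> // n; apply/simple_funP.
Qed.

Lemma strongly_measurable_dist D f v : leb_measurable_set D ->
  strongly_measurable D f -> leb_measurable D (fun x => (rnorm (f x - v))%:E).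
Proof.
move=> mD /strongly_measurableP[s [ss sf]].
apply: (@leb_measurable_cvg _ _ (fun n x => (rnorm (s n x - v))%:E)).
  move=> n; exact: (@finite_valued_measurable _ _ _ (fun w => (rnorm (w - v))%:E) _ (ss n)).
apply: leb_aeS sf => x /[apply] sf.
apply: cvg_EFin; first exact: nearW.
by apply: cvg_rnorm; apply: cvgB sf (cvg_cst _).
Qed.

Lemma strongly_measurable_norm D f : leb_measurable_set D ->
  strongly_measurable D f -> leb_measurable D (fun x => (rnorm (f x))%:E).
Proof.
move=> mD sf; apply: (leb_measurable_ext _ (strongly_measurable_dist 0 mD sf)).
by move=> x _; rewrite subr0.
Qed.

Definition separably_valued D f : Prop :=
  exists y : nat -> V, leb_ae (fun x => D x ->
    forall e : R, 0 < e -> exists k, rnorm (f x - y k) < e).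

Lemma separably_valued_cvg D (f_ : nat -> R -> V) f :
  (forall n, separably_valued D (f_ n)) ->
  leb_ae (fun x => D x -> f_ n x @[n --> \oo] --> f x) ->
  separably_valued D f.
Proof.
move=> /choice[y hy] cf.
exists (fun k => if unpickle k is Some p then y p.1 p.2 else 0).
apply: leb_aeS (leb_aeI cf (leb_ae_forall hy)) => x [+ {}hy] Dx e e0 => /(_ Dx).
move=> /cvg_rnormP /cvgrPdist_lt /(_ (e / 2)) [|N _ hN]; first lra.
have := hN N (leqnn N); rewrite /= sub0r normrN ger0_norm ?rnorm_ge0// => h1.
have [|k hk] := hy N Dx (e / 2); first lra.
exists (pickle (N, k)); rewrite pickleK /=.
apply: (le_lt_trans (rnorm_triangle (f_ N x) _ _)).
rewrite rnormBC; lra.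
Qed.

Lemma finite_valued_separably D (s : R -> V) : finite_valued s -> separably_valued D s.
Proof.
move=> [fs _]; exists (fun k => nth 0 (finmap.enum_fset (fset_set (range s))) k).
apply: leb_aeW => x _ e e0; exists (index (s x) (finmap.enum_fset (fset_set (range s)))).
rewrite nth_index ?subrr ?rnorm0// in_fset_set// inE; by exists x.
Qed.

Lemma strongly_measurable_separably D f :
  strongly_measurable D f -> separably_valued D f.
Proof.
move=> /strongly_measurableP[s [ss sf]].
apply: (separably_valued_cvg _ sf) => n; exact: finite_valued_separably.
Qed.

(** The last two clauses give an integrable bound and make the integral over D
    equal to the integral over the whole line. *)
Definition dominated_approx D f (s : nat -> R -> V) : Prop :=
  [/\ forall n, finite_valued (s n),
      leb_ae (fun x => D x -> s n x @[n --> \oo] --> f x),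
      forall n x, D x -> rnorm (f x - s n x) <= rnorm (f x)
    & forall n x, ~ D x -> s n x = 0].

(** The Pettis criterion: separability of the essential range together with
    measurability of all distance functions gives strong measurability. Both
    conditions pass to almost everywhere limits, while the definition by simple
    functions does not visibly do so. *)
Lemma dominated_approxP D f : leb_measurable_set D -> separably_valued D f ->
  (forall v, leb_measurable D (fun x => (rnorm (f x - v))%:E)) ->
  exists s, dominated_approx D f s.
Proof.
move=> mD [y hy] mf.
pose fD x := if x \in D then f x else 0.
(* With 0 in front of y, every approximation is at least as close to f as 0. *)
pose y' k := if k is k'.+1 then y k' else 0.
have mfD k : leb_measurable setT (fun x => (rnorm (fD x - y' k))%:E).
  rewrite /leb_measurable -(setUv (D : set (lebesgueR R))).
  apply/(measurable_funU (T1 := lebesgueR R) _ mD (measurableC mD)); split.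
    apply: (leb_measurable_ext _ (mf (y' k))) => x Dx.
    by rewrite /fD mem_set.
  apply: (@leb_measurable_ext _ _ (fun=> (rnorm (0 - y' k))%:E)); last exact: measurable_cst.
  by move=> x Dx; rewrite /fD memNset.
exists (fun n x => if x \in D then nearest fD y' n x else 0); split.
- move=> n; apply: finite_valued_if => //; last exact: finite_valued_cst.
  exact: (nearest_finite_valued n mfD).1.
- apply: leb_aeS hy => x hy Dx; rewrite mem_set//.
  have fx : fD x = f x by rewrite /fD mem_set.
  apply/cvg_rnormP/cvgrPdist_lt => e e0; have [k hk] := hy Dx e e0.
  exists k.+1 => // n /= kn; rewrite sub0r normrN ger0_norm ?rnorm_ge0// rnormBC.
  apply: (le_lt_trans _ hk); rewrite -fx.
  exact: (nearest_le fD y' x kn).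
- move=> n x Dx; rewrite mem_set//.
  have := nearest_le fD y' x (leq0n n); rewrite /= subr0.
  by rewrite /fD mem_set.
- by move=> n x Dx; rewrite memNset.
Qed.

Lemma strongly_measurable_approx D f : leb_measurable_set D ->
  strongly_measurable D f -> exists s, dominated_approx D f s.
Proof.
move=> mD mf; apply: dominated_approxP => //.
  exact: strongly_measurable_separably.
by move=> v; exact: strongly_measurable_dist.
Qed.

(** The limit satisfies the Pettis criterion, both parts of which pass to
    limits. *)
Lemma strongly_measurable_cvg D (f_ : nat -> R -> V) f :
  leb_measurable_set D -> (forall n, strongly_measurable D (f_ n)) ->
  leb_ae (fun x => D x -> f_ n x @[n --> \oo] --> f x) ->
  strongly_measurable D f.
Proof.
move=> mD mf cf.
have [|v|s [ss sf _ _]] := @dominated_approxP D f mD; last first.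
- by apply/strongly_measurableP; exists s.
- apply: (@leb_measurable_cvg _ _ (fun n x => (rnorm (f_ n x - v))%:E)).
    by move=> n; exact: strongly_measurable_dist.
  apply: leb_aeS cf => x /[apply] cf.
  apply: cvg_EFin; first exact: nearW.
  by apply: cvg_rnorm; apply: cvgB cf (cvg_cst _).
- apply: (separably_valued_cvg _ cf) => n.
  exact: strongly_measurable_separably.
Qed.

Lemma strongly_measurableB D f h : strongly_measurable D f ->
  strongly_measurable D h -> strongly_measurable D (fun x => f x - h x).
Proof.
move=> /strongly_measurableP[s [ss sf]] /strongly_measurableP[t [tt th]].
apply/strongly_measurableP; exists (fun n x => s n x - t n x); split.
  move=> n; exact: (finite_valued_comp (fun p : V * V => p.1 - p.2)
    (finite_valued_pair (ss n) (tt n))).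
apply: leb_aeS (leb_aeI sf th) => x [{}sf {}th] Dx.
by apply: cvgB; [exact: sf|exact: th].
Qed.

Lemma strongly_measurableS D E f : D `<=` E ->
  strongly_measurable E f -> strongly_measurable D f.
Proof.
move=> DE [s [ss sf]]; exists s; split=> //.
by apply: leb_aeS sf => x sf /DE.
Qed.

Lemma strongly_measurable_patch D f : leb_measurable_set D ->
  strongly_measurable D f ->
  strongly_measurable setT (fun x => if x \in D then f x else 0).
Proof.
move=> mD mf; have [s [ss sf _ s0]] := strongly_measurable_approx mD mf.
apply/strongly_measurableP; exists s; split=> //.
apply: leb_aeS sf => x sf _; case: ifPn => [|xD]; first by rewrite inE.
rewrite (_ : (fun n => s n x) = fun=> 0); first exact: cvg_cst.
by apply/funext => n; apply: s0; rewrite notin_setE in xD.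
Qed.

Lemma strongly_measurable_flip c D f : strongly_measurable D f ->
  strongly_measurable (flip c @^-1` D) (f \o flip c).
Proof.
move=> /strongly_measurableP[s [ss sf]].
apply/strongly_measurableP; exists (fun n => s n \o flip c); split.
  move=> n; split; last by move=> B; exact: (leb_flip c ((ss n).2 B)).1.
  by apply: (sub_finite_set _ (ss n).1) => _ [x _ <-]; exists (flip c x).
exact: (leb_ae_flip c sf).
Qed.

Lemma finite_valued_strongly_measurable D (s : R -> V) :
  finite_valued s -> strongly_measurable D s.
Proof.
move=> ss; apply/strongly_measurableP; exists (fun=> s); split=> //.
by apply: leb_aeW => x _; exact: cvg_cst.
Qed.

End StronglyMeasurable.

(** * The Bochner integral *)

Section SimpleIntegral.
Variable R : realType.
Local Notation mu := (leb R).

(** A finite list L containing the values replaces the range, so that the pair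
    of two finite-valued functions can be handled with the product of two lists.
    *)
Lemma leb_int_finite_valued (T : choiceType) (Q : R -> T) (L : seq T) (c : T -> R) (D : set R) :
  leb_measurable_set D -> finite_valued Q -> uniq L -> (forall x, Q x \in L) ->
  (forall q, 0 <= c q) ->
  leb_int D (fun x => (c (Q x))%:E) =
    (\sum_(q <- L) (c q)%:E * mu (D `&` Q @^-1` [set q]))%E.
Proof.
move=> mD fQ uL QL c0.
have DE : \big[setU/set0]_(q <- L) (D `&` Q @^-1` [set q]) = D.
  rewrite -bigcup_seq; apply/seteqP; split=> [x [q _ []]//|x Dx].
  by exists (Q x) => //=; exact: QL.
have mF q : leb_measurable_set (D `&` Q @^-1` [set q]).
  by apply: measurableI => //; exact: fQ.2.
rewrite -{1}DE /leb_int.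
rewrite (@ge0_integral_bigsetU _ (lebesgueR R) R mu T
  (fun q => D `&` Q @^-1` [set q]) _ L mF uL); first 1 last.
- by move=> q q' _ _ [x [[_ /= <-] [_ /= <-]]].
- by rewrite DE; exact: (@finite_valued_measurable R T Q (fun q => (c q)%:E) D fQ).
- by move=> x _; rewrite lee_fin; exact: c0.
- apply: eq_bigr => q _.
  rewrite -(@integral_cst _ (lebesgueR R) R mu _ (mF q)).
  by apply: (@eq_integral _ (lebesgueR R) R mu) => x; rewrite inE => -[_ /= ->].
Qed.

Lemma leb_integrable (D : set R) (w : R -> R) :
  leb_measurable D (fun x => (w x)%:E) -> (forall x, D x -> 0 <= w x) ->
  (leb_int D (fun x => (w x)%:E) < +oo)%E ->
  mu.-integrable (D : set (lebesgueR R)) (fun x => (w x)%:E).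
Proof.
move=> mw w0 wi; apply/integrableP; split=> //; apply: le_lt_trans wi.
by apply: leb_int_mono => x Dx; rewrite /= ?normr_ge0// ger0_norm ?w0.
Qed.

Lemma leb_int_dominated_cvg0 (D : set R) (d : nat -> R -> R) (w : R -> R) :
  leb_measurable_set D -> (forall n, leb_measurable D (fun x => (d n x)%:E)) ->
  leb_measurable D (fun x => (w x)%:E) -> (forall x, D x -> 0 <= w x) ->
  (leb_int D (fun x => (w x)%:E) < +oo)%E ->
  (forall n x, D x -> `|d n x| <= w x) ->
  leb_ae (fun x => D x -> d n x @[n --> \oo] --> (0 : R)) ->
  leb_int D (fun x => (d n x)%:E) @[n --> \oo] --> 0%E.
Proof.
move=> mD md mw w0 wi dw cd.
have m0 : leb_measurable D (fun=> 0%E) by exact: measurable_cst.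
have cd' : leb_ae (fun x => D x -> (d n x)%:E @[n --> \oo] --> 0%E).
  by apply: leb_aeS cd => x /[apply] cd; apply: cvg_EFin; [exact: nearW|exact: cd].
have dw' : leb_ae (fun x => forall n, D x -> (`|(d n x)%:E| <= (w x)%:E)%E).
  by apply: leb_aeW => x n Dx; rewrite /= lee_fin; exact: dw.
have [_ _] := @dominated_convergence _ (lebesgueR R) R mu D mD
  (fun n x => (d n x)%:E) (fun=> 0%E) (fun x => (w x)%:E) md m0 cd'
  (leb_integrable mw w0 wi) dw'.
by rewrite (@integral0 _ (lebesgueR R) R mu).
Qed.

Variable V : completeNormedModType R[i].
Implicit Types (s t : R -> V) (D : set R).

Lemma finite_valued_list (T : choiceType) (s : R -> T) : finite_valued s ->
  exists L : seq T, [/\ uniq L, forall x, s x \in L & L = finmap.enum_fset (fset_set (range s))].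
Proof.
move=> [fs _]; exists (finmap.enum_fset (fset_set (range s))); split=> //.
by move=> x; rewrite in_fset_set// inE; exists x.
Qed.

(** On the common refinement of the level sets of s and t both integrals are
    double sums with the same weights, and the triangle inequality applies
    termwise. Level sets of infinite measure have weight 0 on the left, hence
    the comparison of fine x with x at the end. *)
Lemma simple_integral_dist_le D s t : leb_measurable_set D ->
  integrable_simple_fun D s -> integrable_simple_fun D t ->
  ((rnorm (simple_integral D s - simple_integral D t))%:E <=
   leb_int D (fun x => (rnorm (s x - t x))%:E))%E.
Proof.
move=> mD [/simple_funP fs is_] [/simple_funP ft it].
have [Ls [uLs sL LsE]] := finite_valued_list fs.
have [Lt [uLt tL LtE]] := finite_valued_list ft.
have split_simple (a b : R -> V) (La Lb : seq V) : finite_valued a -> finite_valued b ->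
    (forall v, v != 0 -> (mu (D `&` a @^-1` [set v]) < +oo)%E) ->
    La = finmap.enum_fset (fset_set (range a)) -> uniq Lb -> (forall x, b x \in Lb) ->
    simple_integral D a = \sum_(v <- La) \sum_(w <- Lb)
      ((fine (mu (D `&` a @^-1` [set v] `&` b @^-1` [set w])))%:C)%C *: v.
  move=> fa fb ia -> uLb bL; rewrite /simple_integral fsbig_finite; last exact: fa.1.
  apply: eq_bigr => v _; rewrite -scaler_suml -rmorph_sum.
  have [->|v0] := eqVneq v 0; first by rewrite !scaler0.
  have mA : leb_measurable_set (D `&` a @^-1` [set v]).
    by apply: measurableI => //; exact: fa.2.
  rewrite sum_fine; last first.
    move=> w _; rewrite ge0_fin_numE //.
    apply: (le_lt_trans _ (ia _ v0)); apply: le_measure; rewrite ?inE//.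
      by apply: measurableI => //; exact: fb.2.
  congr ((fine _)%:C%C *: v).
  transitivity (leb_int (D `&` a @^-1` [set v]) (fun x => 1%:E)).
    by rewrite /leb_int (@integral_cst _ (lebesgueR R) R mu _ mA) mul1e.
  rewrite (leb_int_finite_valued (c := fun=> 1) mA fb uLb bL)//.
  by apply: eq_bigr => w _; rewrite mul1e.
rewrite (split_simple s t Ls Lt)// (split_simple t s Lt Ls)// exchange_big /=.
under [X in _ - X]eq_bigr do under eq_bigr do rewrite setIAC.
rewrite -sumrB.
under eq_bigr do rewrite -sumrB.
under eq_bigr do under eq_bigr do rewrite -scalerBr.
pose P x := (s x, t x); pose L := [seq (v, w) | v <- Ls, w <- Lt].
have fP : finite_valued P by exact: finite_valued_pair.
have uL : uniq L by apply: allpairs_uniq => // -[? ?] [? ?] _ _ [-> ->].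
have PL x : P x \in L by apply/allpairsP; exists (s x, t x); split=> //=.
rewrite (leb_int_finite_valued (c := fun p : V * V => rnorm (p.1 - p.2)) mD fP uL PL); last first.
  by move=> p; exact: rnorm_ge0.
rewrite big_allpairs exchange_big /=.
apply: (@le_trans _ _ (\sum_(v <- Ls) \sum_(w <- Lt)
   (rnorm ((fine (mu (D `&` s @^-1` [set v] `&` t @^-1` [set w])))%:C%C *: (v - w)))%:E)%E).
  under [leRHS]eq_bigr do rewrite sumEFin.
  rewrite sumEFin lee_fin; apply: (le_trans (rnorm_sum _ _)).
  by apply: ler_sum => v _; exact: rnorm_sum.
apply: lee_sum => v _; apply: lee_sum => w _.
have -> : D `&` P @^-1` [set (v, w)] = D `&` s @^-1` [set v] `&` t @^-1` [set w].
  apply/seteqP; split=> [x [Dx [<- <-]]|x [[Dx /= <-] /= <-]]; by split.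
rewrite rnormZ mulrC EFinM; apply: lee_wpmul2l; first by rewrite lee_fin rnorm_ge0.
rewrite ger0_norm ?fine_ge0//.
suff h (x : \bar R) : (0 <= x)%E -> ((fine x)%:E <= x)%E by exact/h/measure_ge0.
by case: x => [r||] //= _; exact: leey.
Qed.

End SimpleIntegral.

Section BochnerIntegral.
Variables (R : realType) (V : completeNormedModType R[i]).
Local Notation mu := (leb R).
Implicit Types (f h : R -> V) (s t : nat -> R -> V) (D : set R).

Lemma bochner_approx_measurable D f s : bochner_approx D f s ->
  strongly_measurable D f.
Proof. by move=> [ss sf _]; exists s; split=> // n; exact: (ss n).1. Qed.

Lemma integrable_simple_strongly_measurable D E (u : R -> V) :
  integrable_simple_fun D u -> strongly_measurable E u.
Proof. by move=> -[/simple_funP + _]; exact: finite_valued_strongly_measurable. Qed.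

Lemma leb_int_rnorm_ge0 D f : (0 <= leb_int D (fun x => (rnorm (f x))%:E))%E.
Proof. by apply: leb_int_ge0 => x _; rewrite lee_fin rnorm_ge0. Qed.

Lemma leb_int_dist_triangle D f1 f2 f3 : leb_measurable_set D ->
  strongly_measurable D f1 -> strongly_measurable D f2 -> strongly_measurable D f3 ->
  (leb_int D (fun x => (rnorm (f1 x - f3 x))%:E) <=
   leb_int D (fun x => (rnorm (f1 x - f2 x))%:E) +
   leb_int D (fun x => (rnorm (f2 x - f3 x))%:E))%E.
Proof.
move=> mD m1 m2 m3; rewrite -leb_intD//.
- apply: leb_int_mono => x _; first by rewrite lee_fin rnorm_ge0.
  by rewrite -EFinD lee_fin rnorm_triangle.
- by apply: strongly_measurable_norm => //; exact: strongly_measurableB.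
- by apply: strongly_measurable_norm => //; exact: strongly_measurableB.
- by move=> x _; rewrite lee_fin rnorm_ge0.
- by move=> x _; rewrite lee_fin rnorm_ge0.
Qed.

Lemma leb_int_distC D f h :
  leb_int D (fun x => (rnorm (f x - h x))%:E) =
  leb_int D (fun x => (rnorm (h x - f x))%:E).
Proof. by apply: leb_int_ext => x _; rewrite rnormBC. Qed.

(** This single estimate yields uniqueness, the norm inequality and continuity
    of the Bochner integral. *)
Lemma bochner_approx_dist_le D f h s t a b : leb_measurable_set D ->
  bochner_approx D f s -> bochner_approx D h t ->
  simple_integral D (s n) @[n --> \oo] --> a ->
  simple_integral D (t n) @[n --> \oo] --> b ->
  ((rnorm (a - b))%:E <= leb_int D (fun x => (rnorm (f x - h x))%:E))%E.
Proof.
move=> mD fs ht sa tb.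
set J := leb_int _ _.
have [->|Jfin] := eqVneq J +oo%E; first exact: leey.
have J0 : (0 <= J)%E by exact: (leb_int_rnorm_ge0 D (fun x => f x - h x)).
have {}Jfin : J \is a fin_num by rewrite ge0_fin_numE // lt_neqAle Jfin leey.
have [fs1 _ fs0] := fs; have [ht1 _ ht0] := ht.
have mf := bochner_approx_measurable fs; have mh := bochner_approx_measurable ht.
have -> : J = (0 + (J + 0))%E by rewrite adde0 add0e.
have c1 : (rnorm (simple_integral D (s n) - simple_integral D (t n)))%:E @[n --> \oo]
    --> (rnorm (a - b))%:E.
  by apply: cvg_EFin; [exact: nearW|apply: cvg_rnorm; exact: cvgB].
have c2 : (leb_int D (fun x => (rnorm (f x - s n x))%:E) +
    (J + leb_int D (fun x => (rnorm (h x - t n x))%:E)))%E @[n --> \oo] --> (0 + (J + 0))%E.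
  apply: cvgeD => //.
  have d : (J +? 0)%E by rewrite fin_num_adde_defl.
  exact: (cvgeD d (cvg_cst J) ht0).
apply: (lee_cvg_to c1 c2).
apply: nearW => n /=.
apply: (le_trans (simple_integral_dist_le mD (fs1 n) (ht1 n))).
have ms := @integrable_simple_strongly_measurable _ D _ (fs1 n).
have mt := @integrable_simple_strongly_measurable _ D _ (ht1 n).
apply: (le_trans (leb_int_dist_triangle mD ms mf mt)).
rewrite leb_int_distC leeD2l//.
exact: leb_int_dist_triangle.
Qed.

Lemma bochner_approx_cvg D f s : leb_measurable_set D ->
  bochner_approx D f s -> exists v : V, simple_integral D (s n) @[n --> \oo] --> v.
Proof.
move=> mD fs; have [fs1 _ fs0] := fs.
have mf := bochner_approx_measurable fs.
apply: rnorm_cauchy => e e0.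
have /fine_cvgP[fin /cvgrPdist_lt /(_ (e / 2))] := fs0.
case; first lra.
move=> N1 _ h1; case: fin => N2 _ h2.
exists (maxn N1 N2) => // N; rewrite /= geq_max => /andP[N1N N2N] m n Nm Nn.
have small k : (N <= k)%N ->
    (leb_int D (fun x => (rnorm (f x - s k x))%:E) < (e / 2)%:E)%E.
  move=> Nk; have := h1 k (leq_trans N1N Nk); have := h2 k (leq_trans N2N Nk).
  move=> /= fk; rewrite sub0r normrN ger0_norm; last first.
    by apply: fine_ge0; exact: (leb_int_rnorm_ge0 D (fun x => f x - s k x)).
  by rewrite -[X in _ -> (X < _)%E](fineK fk) lte_fin.
rewrite -lte_fin.
apply: (le_lt_trans (simple_integral_dist_le mD (fs1 m) (fs1 n))).
have mm := @integrable_simple_strongly_measurable _ D _ (fs1 m).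
have mn := @integrable_simple_strongly_measurable _ D _ (fs1 n).
apply: (le_lt_trans (leb_int_dist_triangle mD mm mf mn)).
rewrite leb_int_distC.
have -> : e%:E = ((e / 2)%:E + (e / 2)%:E)%E by rewrite -EFinD; congr EFin; lra.
by apply: lteD; exact: small.
Qed.

Lemma is_bochner_integral_dist_le D f h a b : leb_measurable_set D ->
  is_bochner_integral D f a -> is_bochner_integral D h b ->
  ((rnorm (a - b))%:E <= leb_int D (fun x => (rnorm (f x - h x))%:E))%E.
Proof. by move=> mD [s [fs sa]] [t [ht tb]]; exact: (bochner_approx_dist_le mD fs ht). Qed.

Lemma is_bochner_integral_unique D f a b : leb_measurable_set D ->
  is_bochner_integral D f a -> is_bochner_integral D f b -> a = b.
Proof.
move=> mD fa fb; have := is_bochner_integral_dist_le mD fa fb.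
rewrite (_ : leb_int _ _ = 0%E); last first.
  rewrite (@leb_int_ext _ _ _ (cst 0%E)); first exact: integral0.
  by move=> x _; rewrite subrr rnorm0.
rewrite lee_fin => h; apply/eqP; rewrite -subr_eq0 -rnorm_eq0.
by rewrite eq_le h rnorm_ge0.
Qed.

Lemma bochner_eq D f a : leb_measurable_set D ->
  is_bochner_integral D f a -> bochner D f = a.
Proof.
move=> mD fa; apply: (is_bochner_integral_unique mD _ fa).
by apply: xgetPex; exists a.
Qed.

Lemma bochnerP D f : leb_measurable_set D -> bochner_integrable D f ->
  is_bochner_integral D f (bochner D f).
Proof.
move=> mD [s fs]; have [v sv] := bochner_approx_cvg mD fs.
by apply: xgetPex; exists v, s.
Qed.

Lemma dominated_approx_bochner D f s : leb_measurable_set D ->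
  (leb_int D (fun x => (rnorm (f x))%:E) < +oo)%E ->
  strongly_measurable D f -> dominated_approx D f s -> bochner_approx D f s.
Proof.
move=> mD fi mf [ss sf sle _].
have nf := strongly_measurable_norm mD mf.
have msn n : strongly_measurable D (s n) by exact: finite_valued_strongly_measurable.
split=> //.
- move=> n; split; first exact/simple_funP.
  move=> v v0; set A := D `&` _.
  have mA : leb_measurable_set A by apply: measurableI => //; exact: (ss n).2.
  have v0' : 0 < rnorm v by rewrite lt_def rnorm_ge0 rnorm_eq0 v0.
  have : ((rnorm v)%:E * mu A < +oo)%E.
    rewrite -(@integral_cst _ (lebesgueR R) R mu _ mA).
    apply: (@le_lt_trans _ _ (leb_int D (fun x => (rnorm (f x))%:E + (rnorm (f x))%:E)%E)); last first.
      rewrite leb_intD//; first exact: lte_add_pinfty.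
        by move=> x _; rewrite lee_fin rnorm_ge0.
      by move=> x _; rewrite lee_fin rnorm_ge0.
    apply: (@le_trans _ _ (leb_int A (fun x => (rnorm (f x))%:E + (rnorm (f x))%:E)%E)); last first.
      by apply: leb_int_subset => [x _|x []//]; rewrite -EFinD lee_fin addr_ge0// rnorm_ge0.
    apply: leb_int_mono => x [Dx /= sx]; first by rewrite lee_fin rnorm_ge0.
    rewrite -EFinD lee_fin -sx.
    have := rnorm_sub_le (s n x) (f x); have := sle n x Dx; rewrite rnormBC; lra.
  case: (mu A) => [r||]; rewrite ?ltry ?ltNyr//.
  by rewrite gt0_muley ?lte_fin.
- apply: (leb_int_dominated_cvg0 mD _ nf _ fi).
  + by move=> n; apply: strongly_measurable_norm => //; exact: strongly_measurableB.
  + by move=> x _; exact: rnorm_ge0.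
  + by move=> n x Dx; rewrite ger0_norm ?rnorm_ge0// sle.
  apply: leb_aeS sf => x /[apply] sf.
  rewrite -(rnorm0 V) -(subrr (f x)); apply: cvg_rnorm.
  by apply: cvgB; [exact: cvg_cst|exact: sf].
Qed.

Lemma bochner_integrable_norm D f : leb_measurable_set D ->
  strongly_measurable D f -> (leb_int D (fun x => (rnorm (f x))%:E) < +oo)%E ->
  bochner_integrable D f.
Proof.
move=> mD mf fi; have [s fs] := strongly_measurable_approx mD mf.
by exists s; exact: dominated_approx_bochner.
Qed.

Lemma bochner_dist_le D f h : leb_measurable_set D ->
  bochner_integrable D f -> bochner_integrable D h ->
  ((rnorm (bochner D f - bochner D h))%:E <=
    leb_int D (fun x => (rnorm (f x - h x))%:E))%E.
Proof. by move=> mD fi hi; apply: is_bochner_integral_dist_le => //; exact: bochnerP. Qed.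

(** Extension by zero makes integrals over the varying rays ]-oo, x[ comparable:
    they all become integrals over the whole line. *)
Lemma bochner_patch D f : leb_measurable_set D ->
  strongly_measurable D f -> (leb_int D (fun x => (rnorm (f x))%:E) < +oo)%E ->
  bochner setT (fun x => if x \in D then f x else 0) = bochner D f.
Proof.
move=> mD mf fi; set fD := fun x => _.
have [s fs] := strongly_measurable_approx mD mf.
have fDs : dominated_approx setT fD s.
  have [ss sf sle s0] := fs; split=> //.
  - apply: leb_aeS sf => x sf _; rewrite /fD; case: ifPn => [|xD]; first by rewrite inE.
    rewrite (_ : (fun n => s n x) = fun=> 0); first exact: cvg_cst.
    by apply/funext => n; apply: s0; rewrite notin_setE in xD.
  - move=> n x _; rewrite /fD; case: ifPn => [|xD]; first by rewrite inE; exact: sle.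
    by rewrite s0 ?subrr//; rewrite notin_setE in xD.
  - by move=> n x /(_ I).
have fDi : (leb_int setT (fun x => (rnorm (fD x))%:E) < +oo)%E.
  move: fi; rewrite /leb_int (@integral_mkcond _ (lebesgueR R) R mu D).
  congr (_ < _)%E; apply: leb_int_ext => x _; rewrite patchE /fD.
  by case: ifP => //; rewrite rnorm0.
have Ds := dominated_approx_bochner mD fi mf fs.
have Ts := dominated_approx_bochner measurableT fDi (strongly_measurable_patch mD mf) fDs.
have [v sv] := bochner_approx_cvg mD Ds.
have -> : bochner D f = v by apply: bochner_eq => //; exists s.
apply: bochner_eq; first exact: measurableT.
exists s; split=> //.
rewrite (_ : (fun n => _) = fun n => simple_integral D (s n)) //.
apply/funext => n; rewrite /simple_integral.
apply: eq_fsbigr => w _; have [->|w0] := eqVneq w 0; first by rewrite !scaler0.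
congr ((fine (mu _))%:C%C *: _).
apply/seteqP; split=> [x [_ /= sx]|x []//]; split=> //.
apply: contrapT => Dx; case: fs => _ _ _ /(_ n x Dx).
by rewrite sx => /eqP; rewrite (negbTE w0).
Qed.

(** All changes of variables below, including translations, are reflections of
    this form: composing with the reflection about one point before and about
    another after amounts to a translation. *)
Lemma bochner_flip c D f : leb_measurable_set D -> bochner_integrable D f ->
  bochner_integrable (flip c @^-1` D) (f \o flip c) /\
  bochner (flip c @^-1` D) (f \o flip c) = bochner D f.
Proof.
move=> mD fi; have [s [fs sv]] := bochnerP mD fi.
have mD' := (leb_flip c mD).1.
have [ss sf s0] := fs; have mf := bochner_approx_measurable fs.
have fs' : bochner_approx (flip c @^-1` D) (f \o flip c) (fun n => s n \o flip c).
  split.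
  - move=> n; have [/simple_funP [fn mn] fin] := ss n; split.
      apply/simple_funP; split; last by move=> B; exact: (leb_flip c (mn B)).1.
      by apply: (sub_finite_set _ fn) => _ [x _ <-]; exists (flip c x).
    move=> v v0; rewrite -[X in mu X]/(flip c @^-1` (D `&` s n @^-1` [set v])).
    by rewrite (leb_flip c _).2; [exact: fin|apply: measurableI => //; exact: mn].
  - exact: (leb_ae_flip c sf).
  - rewrite (_ : (fun n => _) = fun n => leb_int D (fun x => (rnorm (f x - s n x))%:E)) //.
    apply/funext => n; rewrite [RHS](@leb_int_flip _ c)//.
      apply: strongly_measurable_norm => //; apply: strongly_measurableB => //.
      exact: integrable_simple_strongly_measurable (ss n).
    by move=> x _; rewrite lee_fin rnorm_ge0.
split; first by eexists; exact: fs'.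
apply: bochner_eq => //; exists (fun n => s n \o flip c); split=> //.
rewrite (_ : (fun n => _) = fun n => simple_integral D (s n)) //.
apply/funext => n; have [/simple_funP [fn mn] fin] := ss n.
rewrite /simple_integral.
have -> : range (s n \o flip c) = range (s n).
  apply/seteqP; split=> _ [x _ <-]; exists (flip c x) => //=.
  by rewrite flipK.
apply: eq_fsbigr => w _; congr ((fine _)%:C%C *: _).
rewrite -[X in mu X = _]/(flip c @^-1` (D `&` s n @^-1` [set w])).
by rewrite (leb_flip c _).2//; apply: measurableI => //; exact: mn.
Qed.

End BochnerIntegral.

(** * Dominated convergence for the Bochner integral *)

Section DominatedBochner.
Variables (R : realType) (V : completeNormedModType R[i]).

Lemma bochner_dominated_integrable (D : set R) (f : R -> V) (w : R -> R) :
  leb_measurable_set D -> strongly_measurable D f ->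
  (leb_int D (fun x => (w x)%:E) < +oo)%E ->
  (forall x, D x -> rnorm (f x) <= w x) -> bochner_integrable D f.
Proof.
move=> mD mf wi fw; apply: bochner_integrable_norm => //; apply: le_lt_trans wi.
by apply: leb_int_mono => x Dx; rewrite lee_fin ?rnorm_ge0// fw.
Qed.

Lemma bochner_dominated_cvg (D : set R) (f_ : nat -> R -> V) (f : R -> V) (w : R -> R) :
  leb_measurable_set D -> (forall k, strongly_measurable D (f_ k)) ->
  strongly_measurable D f -> leb_measurable D (fun x => (w x)%:E) ->
  (leb_int D (fun x => (w x)%:E) < +oo)%E ->
  (forall k x, D x -> rnorm (f_ k x) <= w x) ->
  (forall x, D x -> rnorm (f x) <= w x) ->
  leb_ae (fun x => D x -> f_ k x @[k --> \oo] --> f x) ->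
  bochner D (f_ k) @[k --> \oo] --> bochner D f.
Proof.
move=> mD mf_ mf mw wi fw_ fw cf.
have w0 x : D x -> 0 <= w x by move=> Dx; exact: le_trans (rnorm_ge0 _) (fw x Dx).
have fi := bochner_dominated_integrable mD mf wi fw.
have fi_ k := bochner_dominated_integrable mD (mf_ k) wi (fw_ k).
have w2i : (leb_int D (fun x => (w x + w x)%:E) < +oo)%E.
  have -> : leb_int D (fun x => (w x + w x)%:E) =
      (leb_int D (fun x => (w x)%:E) + leb_int D (fun x => (w x)%:E))%E.
    by rewrite -(leb_intD mD mw mw) // => x Dx; rewrite lee_fin; exact: w0.
  exact: lte_add_pinfty.
have mw2 : leb_measurable D (fun x => (w x + w x)%:E).
  by move/measurable_EFinP : mw => mw; apply/measurable_EFinP; exact: measurable_funD.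
have dw k x : D x -> rnorm (f_ k x - f x) <= w x + w x.
  move=> Dx; apply: (le_trans (rnormD _ _)).
  by rewrite rnormN; apply: lerD; [exact: fw_|exact: fw].
have int0 : leb_int D (fun x => (rnorm (f_ k x - f x))%:E) @[k --> \oo] --> 0%E.
  apply: (leb_int_dominated_cvg0 mD _ mw2 _ w2i).
  - by move=> n; apply: strongly_measurable_norm => //; exact: strongly_measurableB.
  - by move=> x Dx; apply: addr_ge0; exact: w0.
  - by move=> k x Dx; rewrite ger0_norm ?rnorm_ge0//; exact: dw.
  apply: leb_aeS cf => x /[apply] sf.
  rewrite -(rnorm0 V) -(subrr (f x)); apply: cvg_rnorm.
  by apply: cvgB; [exact: sf|exact: cvg_cst].
apply: (@cvg_rnorm_squeeze _ _ _ _ _ _ _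
  (fun k => fine (leb_int D (fun x => (rnorm (f_ k x - f x))%:E)))).
  move=> k; have le := bochner_dist_le mD (fi_ k) fi.
  rewrite -lee_fin fineK// ge0_fin_numE; last exact: (leb_int_rnorm_ge0 D (fun x => f_ k x - f x)).
  apply: le_lt_trans w2i; apply: leb_int_mono => x Dx; rewrite lee_fin.
    exact: rnorm_ge0.
  exact: dw.
by have /fine_cvgP[] := int0.
Qed.

End DominatedBochner.

(** * Strongly continuous operator families *)

Section OperatorFamilies.
Variables (R : realType) (X Y : completeNormedModType R[i]).
Implicit Types (T : {linear X -> Y}) (U : set R).

Lemma opnorm_has_sup T : bounded_op T ->
  has_sup [set rnorm (T x) | x in [set x : X | rnorm x <= 1]].
Proof.
move=> [M TM]; split; first by exists (rnorm (T 0)), 0 => //=; rewrite rnorm0.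
exists (Num.max M 0) => _ [x /= x1 <-].
apply: (le_trans (TM x)); have [M0|M0] := leP 0 M; first exact: ler_piMr.
by apply: mulr_le0_ge0; [exact: ltW|exact: rnorm_ge0].
Qed.

(** For an unbounded operator the supremum takes its default value 0. *)
Lemma opnorm_ge0 T : 0 <= opnorm T.
Proof.
rewrite /opnorm; set A := (X in sup X).
have [sA|/sup_out -> //] := pselect (has_sup A).
apply: (ub_le_sup sA.2); exists 0; rewrite /= ?rnorm0//.
by rewrite linear0 rnorm0.
Qed.

Lemma opnorm_le T x : bounded_op T -> rnorm (T x) <= opnorm T * rnorm x.
Proof.
move=> bT; have [->|x0] := eqVneq x 0; first by rewrite linear0 !rnorm0 mulr0.
have nx : 0 < rnorm x by rewrite lt_def rnorm_ge0 rnorm_eq0 x0.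
rewrite -ler_pdivrMr// mulrC -{1}(ger0_norm (ltW nx)) -normfV -rnormZ -linearZ.
apply: (ub_le_sup (opnorm_has_sup bT).2); exists ((((rnorm x)^-1)%:C)%C *: x) => //=.
by rewrite rnormZ normfV ger0_norm ?rnorm_ge0// mulVf// gt_eqF.
Qed.

Definition seq_continuous (K : X -> Y) : Prop :=
  forall (u : nat -> X) v, u n @[n --> \oo] --> v -> K (u n) @[n --> \oo] --> K v.

Lemma bounded_op_seq_continuous T : bounded_op T -> seq_continuous T.
Proof.
move=> bT u v /cvg_rnormP uv.
apply: (@cvg_rnorm_squeeze _ _ _ _ _ _ _ (fun n => opnorm T * rnorm (u n - v))).
  by move=> n; rewrite -linearB; exact: opnorm_le.
by rewrite -(mulr0 (opnorm T)); apply: cvgM => //; exact: cvg_cst.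
Qed.

(** The operator norm is a supremum of continuous functions, hence lower
    semicontinuous on ]0, +oo[. *)
Lemma opnorm_measurable (T : R -> {linear X -> Y}) : strongly_continuous T ->
  leb_measurable `]0, +oo[ (fun t => (opnorm (T t))%:E).
Proof.
move=> [bT cT] mD; apply: (measurability _ (ErealGenOInfty.measurableE R)) => // _ [_ [c ->] <-].
apply: leb_measurable_open; rewrite openE /= => t [/=]; rewrite !in_itv/= !andbT lte_fin => t0 ct.
have [_ [x /= x1 <-] cx] := sup_gt (opnorm_has_sup (bT _ t0)).1 ct.
have /cvg_rnorm /cvgr_gt /(_ _ cx) H := cT x t t0.
rewrite /interior; near=> s.
have s0 : 0 < s by near: s; apply: (@cvgr_gt _ _ (nbhs t) _ id t) => //; exact: cvg_id.
rewrite /= !in_itv/= !andbT lte_fin; split => //.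
apply: (@lt_le_trans _ _ (rnorm (T s x))); first by near: s; exact: H.
apply: (ub_le_sup (opnorm_has_sup (bT _ s0)).2); by exists x.
Unshelve. all: by end_near. Qed.

(** Turns the density of the rationals into an enumerated family, as the Pettis
    criterion asks for. *)
Lemma rat_dense_in (t : R) (P : set R) : nbhs t P ->
  exists k, P (if unpickle k is Some q then ratr (q : rat) else 0).
Proof.
move=> /nbhs_ballP [e /= e0 teP].
have [q] : exists q, ratr q \in `](t - e), (t + e)[ by apply: rat_in_itvoo; lra.
rewrite in_itv/= => /andP[q1 q2].
exists (pickle q); rewrite pickleK; apply: teP; rewrite /ball /= ltr_distlC; lra.
Qed.

Lemma continuous_strongly_measurable (Z : completeNormedModType R[i]) U (u : R -> Z) : open U ->
  (forall s, U s -> {for s, continuous u}) -> strongly_measurable U u.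
Proof.
move=> oU cu; have mU := leb_measurable_open oU.
have [||s [ss su _ _]] := @dominated_approxP _ _ U u mU; last first.
- by apply/strongly_measurableP; exists s.
- move=> v; apply/measurable_EFinP.
  have : measurable_fun U (fun x => rnorm (u x - v)).
    apply: open_continuous_measurable_fun => // s; rewrite inE => /cu us.
    apply: cvg_rnorm; apply: cvgB; [exact: us|exact: cvg_cst].
  move=> h _ B mB; apply: leb_measurable_borel; apply: h => //; exact: open_measurable.
exists (fun k => u (if unpickle k is Some q then ratr (q : rat) else 0)).
apply: leb_aeW => s Us e e0.
have /cvg_rnormP /cvgrPdist_lt /(_ _ e0) H := cu s Us.
have [k hk] := rat_dense_in H; exists k.
by move: hk; rewrite sub0r normrN ger0_norm ?rnorm_ge0// rnormBC.
Qed.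

(** For h with finitely many values the essential range is separable because K q
    v with q rational and v a value of h is dense in it; the general case is a
    limit, by continuity of each K s. *)
Lemma strongly_measurable_op U (K : R -> X -> Y) (h : R -> X) : open U ->
  (forall v s, U s -> {for s, continuous (K ^~ v)}) ->
  (forall s, U s -> seq_continuous (K s)) ->
  strongly_measurable U h -> strongly_measurable U (fun s => K s (h s)).
Proof.
move=> oU cK bK /strongly_measurableP[a [fa ah]].
have mU := leb_measurable_open oU.
apply: (@strongly_measurable_cvg _ _ U (fun n s => K s (a n s))) => //; last first.
  by apply: leb_aeS ah => s ah Us; apply: bK => //; exact: ah.
move=> n {ah}; move: (a n) (fa n) => {fa}a [fa ma].
have [||s [ss su _ _]] := @dominated_approxP _ _ U (fun s => K s (a s)) mU; last first.
- by apply/strongly_measurableP; exists s.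
- move=> w _ B mB.
  have -> : U `&` (fun x => (rnorm (K x (a x) - w))%:E) @^-1` B =
     \bigcup_(v in range a) (a @^-1` [set v] `&`
        (U `&` (fun x => (rnorm (K x v - w))%:E) @^-1` B)).
    apply/seteqP; split=> [x [Ux Bx]|x [v _ [/= <-] [Ux Bx]]]; last by split.
    by exists (a x) => //; exists x.
  apply: fin_bigcup_measurable => // v _; apply: measurableI; first exact: ma.
  have := strongly_measurable_dist w mU (continuous_strongly_measurable oU (cK v)).
  by apply.
exists (fun k => let p := if unpickle k is Some p then p else (0, 0)%N in
  K (if unpickle p.1 is Some q then ratr (q : rat) else 0)
    (nth 0 (finmap.enum_fset (fset_set (range a))) p.2)).
apply: leb_aeW => s Us e e0.
have /cvg_rnormP /cvgrPdist_lt /(_ _ e0) H := cK (a s) s Us.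
have [k hk] := rat_dense_in H.
exists (pickle (k, index (a s) (finmap.enum_fset (fset_set (range a))))).
rewrite pickleK /= nth_index; last by rewrite in_fset_set// inE; exists s.
by move: hk; rewrite sub0r normrN ger0_norm ?rnorm_ge0// rnormBC.
Qed.

End OperatorFamilies.

(** * Continuous truncations of an operator family *)

Section Truncation.
Variables (R : realType) (X Y : completeNormedModType R[i]).
Variable T : R -> {linear X -> Y}.
Hypothesis T_sc : strongly_continuous T.

Lemma cvg_realZ (S : Type) (F : set_system S) (FF : Filter F)
    (a : S -> R) (a0 : R) (u : S -> Y) (u0 : Y) :
  a t @[t --> F] --> a0 -> u t @[t --> F] --> u0 ->
  ((a t)%:C)%C *: u t @[t --> F] --> (a0%:C)%C *: u0.
Proof.
move=> aa0 uu0.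
apply: (@cvg_rnorm_squeeze _ _ _ _ _ _ _
  (fun t => `|a t| * rnorm (u t - u0) + `|a t - a0| * rnorm u0)).
  move=> t; have -> : ((a t)%:C)%C *: u t - (a0%:C)%C *: u0 =
    ((a t)%:C)%C *: (u t - u0) + ((a t - a0)%:C)%C *: u0.
    by rewrite scalerBr rmorphB scalerBl addrA subrK.
  by apply: (le_trans (rnormD _ _)); rewrite !rnormZ.
have -> : 0 = `|a0| * 0 + `|a0 - a0| * rnorm u0 by rewrite subrr normr0 mulr0 mul0r addr0.
apply: cvgD; apply: cvgM.
- exact: cvg_norm.
- by move/cvg_rnormP : uu0.
- by apply: cvg_norm; apply: cvgB => //; exact: cvg_cst.
- exact: cvg_cst.
Qed.

Definition cutoff (n : nat) (r : R) : R :=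
  Num.max 0 (Num.min 1 (Num.min (n.+1%:R * r - 1) (n.+1%:R - r))).

Definition clip (n : nat) (r : R) : R := Num.max n.+1%:R^-1 (Num.min r n.+1%:R).

(** Cutting off near 0 and at infinity makes the family continuous on the whole
    line and, on each vector, bounded. Clipping the argument keeps T within a
    compact interval of positive times; where the cutoff is nonzero it has no
    effect. *)
Definition truncT (n : nat) (r : R) (v : X) : Y := ((cutoff n r)%:C)%C *: T (clip n r) v.

Lemma cutoff_ge0 n r : 0 <= cutoff n r.
Proof. by rewrite /cutoff le_max lexx. Qed.

Lemma cutoff_le1 n r : cutoff n r <= 1.
Proof. by rewrite /cutoff ge_max ler01 ge_min lexx. Qed.

Lemma cutoff_continuous n : continuous (cutoff n).
Proof.
move=> r.
apply: (@continuous_max R R (fun=> 0)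
  (fun s => Num.min 1 (Num.min (n.+1%:R * s - 1) (n.+1%:R - s)))).
  exact: cvg_cst.
apply: (@continuous_min R R (fun=> 1) (fun s => Num.min (n.+1%:R * s - 1) (n.+1%:R - s))).
  exact: cvg_cst.
apply: (@continuous_min R R (fun s => n.+1%:R * s - 1) (fun s => n.+1%:R - s)).
  by apply: cvgB; [apply: cvgM; [exact: cvg_cst|exact: cvg_id]|exact: cvg_cst].
by apply: cvgB; [exact: cvg_cst|exact: cvg_id].
Qed.

Lemma clip_continuous n : continuous (clip n).
Proof.
move=> r; apply: (@continuous_max R R (fun=> n.+1%:R^-1) (fun s => Num.min s n.+1%:R)).
  exact: cvg_cst.
by apply: (@continuous_min R R id (fun=> n.+1%:R)); [exact: cvg_id|exact: cvg_cst].
Qed.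

Lemma clip_bounds n r : clip n r \in `[n.+1%:R^-1, n.+1%:R].
Proof.
rewrite in_itv/= /clip le_max lexx /= ge_max ge_min lexx orbT andbT.
by apply: (@le_trans _ _ 1); rewrite ?invf_le1 ?ltr0n// ler1n.
Qed.

Lemma clip_gt0 n r : 0 < clip n r.
Proof.
by have := clip_bounds n r; rewrite in_itv/= => /andP[+ _]; apply: lt_le_trans; rewrite invr_gt0 ltr0n.
Qed.

Lemma cutoff_clip n r : cutoff n r = 0 \/ 0 < r /\ clip n r = r.
Proof.
have n0 : 0 < n.+1%:R :> R by rewrite ltr0n.
have [h|h] := leP (Num.min 1 (Num.min (n.+1%:R * r - 1) (n.+1%:R - r))) 0.
  by left; rewrite /cutoff max_l.
right; move: h; rewrite !lt_min => /and3P[_ h1 h2].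
have r1 : n.+1%:R^-1 <= r by rewrite -[X in X <= _]mulr1 mulrC ler_pdivrMr// mulrC; lra.
split; first by apply: lt_le_trans r1; rewrite invr_gt0.
by rewrite /clip min_l ?max_r//; lra.
Qed.

Lemma cutoff_clip_near r : 0 < r -> \forall n \near \oo, cutoff n r = 1 /\ clip n r = r.
Proof.
move=> r0; near=> n.
have n0 : 0 < n.+1%:R :> R by rewrite ltr0n.
have h1 : 2 / r <= n.+1%:R.
  by apply: (@le_trans _ _ n%:R); [near: n; exact: nbhs_infty_ger|rewrite ler_nat].
have h2 : r + 1 <= n.+1%:R.
  by apply: (@le_trans _ _ n%:R); [near: n; exact: nbhs_infty_ger|rewrite ler_nat].
have h3 : 2 <= n.+1%:R * r by rewrite -ler_pdivrMr.
have h4 : cutoff n r = 1.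
  by rewrite /cutoff min_l ?max_r// le_min; apply/andP; split; lra.
by split=> //; have [|[]//] := cutoff_clip n r; rewrite h4 => /eqP; rewrite oner_eq0.
Unshelve. all: by end_near. Qed.

Lemma truncT0 n r : truncT n r 0 = 0.
Proof. by rewrite /truncT linear0 scaler0. Qed.

Lemma truncT_le0 n r v : r <= 0 -> truncT n r v = 0.
Proof.
move=> r0; rewrite /truncT; have [->|[]] := cutoff_clip n r; first by rewrite scale0r.
by rewrite ltNge r0.
Qed.

Lemma truncT_le n r v : 0 < r -> rnorm (truncT n r v) <= opnorm (T r) * rnorm v.
Proof.
move=> r0; have bT := T_sc.1 _ r0.
rewrite /truncT rnormZ ger0_norm ?cutoff_ge0//.
have [->|[_ ->]] := cutoff_clip n r.
  by rewrite mul0r mulr_ge0// ?rnorm_ge0// opnorm_ge0.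
apply: le_trans (opnorm_le _ bT).
by rewrite ler_piMl// ?rnorm_ge0// cutoff_le1.
Qed.

Lemma T_clip_continuous n v : continuous (fun r => T (clip n r) v).
Proof.
move=> r; apply: (@continuous_comp _ _ _ (clip n) (fun s => T s v)).
  exact: clip_continuous.
exact: T_sc.2 (clip_gt0 _ _).
Qed.

Lemma truncT_continuous n v : continuous (truncT n ^~ v).
Proof. by move=> r; apply: cvg_realZ; [exact: cutoff_continuous|exact: T_clip_continuous]. Qed.

Lemma truncT_seq_continuous n r : seq_continuous (truncT n r).
Proof.
move=> u v uv; apply: cvg_realZ; first exact: cvg_cst.
exact: (bounded_op_seq_continuous (T_sc.1 _ (clip_gt0 n r))).
Qed.

(** The clipped time stays in a compact interval, on which the norm of the orbit
    of v attains its maximum. *)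
Lemma truncT_bounded n v : exists C, forall r, rnorm (truncT n r v) <= C.
Proof.
have n1 : n.+1%:R^-1 <= n.+1%:R :> R.
  by have := clip_bounds n 0; rewrite in_itv/= => /andP[]; exact: le_trans.
have [|c _ cmax] := @EVT_max R (fun r => rnorm (T (clip n r) v)) _ _ n1.
  by apply: continuous_subspaceT => r; apply: cvg_rnorm; exact: T_clip_continuous.
exists (rnorm (T (clip n c) v)) => r; rewrite /truncT rnormZ ger0_norm ?cutoff_ge0//.
have := cmax _ (clip_bounds n r).
have -> : clip n (clip n r) = clip n r.
  have := clip_bounds n r; rewrite in_itv/= => /andP[h1 h2].
  by rewrite {1}/clip min_l// max_r.
apply: le_trans; by rewrite ler_piMl ?rnorm_ge0// cutoff_le1.
Qed.

Lemma truncT_bounded_finite_valued n (a : R -> X) : finite_valued a ->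
  exists C, forall r s, rnorm (truncT n r (a s)) <= C.
Proof.
move=> fa; have [L [_ aL _]] := finite_valued_list fa.
suff [C hC] : exists C, forall v, v \in L -> forall r, rnorm (truncT n r v) <= C.
  by exists C => r s; exact: hC.
elim: {aL} L => [|v L [C hC]]; first by exists 0.
have [C' hC'] := truncT_bounded n v; exists (Num.max C C') => w.
rewrite inE => /orP[/eqP -> r|/hC {}hC r]; rewrite le_max.
  by rewrite hC' orbT.
by rewrite hC.
Qed.

End Truncation.

(** * Integrability and measurability of the convolution *)

Section ConvolutionMeasurability.
Variables (R : realType) (X Y : completeNormedModType R[i]).
Variables (T : R -> {linear X -> Y}) (g : R -> X).
Local Notation mu := (leb R).
Hypothesis T_sc : strongly_continuous T.
Hypothesis g_meas : strongly_measurable setT g.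
Hypothesis Tg_int : forall x, (leb_int `]-oo, x[
   (fun s => (opnorm (T (x - s)) * rnorm (g s))%:E) < +oo)%E.

(** Only the times x - s with s < x occur, and these are positive. *)
Lemma strongly_measurable_convolved x (h : R -> X) : strongly_measurable setT h ->
  strongly_measurable `]-oo, x[ (fun s => T (x - s) (h s)).
Proof.
move=> mh; apply: (strongly_measurable_op (K := fun s v => T (x - s) v)).
- exact: interval_open.
- move=> v s; rewrite /= in_itv/= => sx.
  apply: (@continuous_comp _ _ _ (fun s => x - s) (fun r => T r v)).
    by apply: cvgB; [exact: cvg_cst|exact: cvg_id].
  by apply: T_sc.2; rewrite subr_gt0.
- move=> s; rewrite /= in_itv/= => sx.
  by apply: bounded_op_seq_continuous; apply: T_sc.1; rewrite subr_gt0.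
- exact: strongly_measurableS mh.
Qed.

Lemma opnorm_flip_measurable x :
  leb_measurable `]-oo, x[ (fun s => (opnorm (T (x - s)))%:E).
Proof.
have := @leb_measurable_flip _ x _ _ (opnorm_measurable T_sc); congr (leb_measurable _ _).
apply/seteqP; split=> s /=; rewrite !in_itv/= andbT /flip; lra.
Qed.

Lemma weight_measurable x (u : R -> R) : leb_measurable setT (fun s => (u s)%:E) ->
  leb_measurable `]-oo, x[ (fun s => (opnorm (T (x - s)) * u s)%:E).
Proof.
move=> mu_; apply/measurable_EFinP; apply: measurable_funM.
  exact/measurable_EFinP/opnorm_flip_measurable.
apply/measurable_EFinP; apply: (leb_measurableS _ _ mu_) => //; exact: measurableT.
Qed.

Lemma convolved_le x s v : s < x -> rnorm (T (x - s) v) <= opnorm (T (x - s)) * rnorm v.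
Proof. by move=> sx; apply: opnorm_le; apply: T_sc.1; rewrite subr_gt0. Qed.

Lemma convolution_integrable_of_weight : convolution_integrable T g.
Proof.
move=> x; apply: (bochner_dominated_integrable _ _ (Tg_int x)).
- exact: leb_measurable_itv.
- exact: strongly_measurable_convolved.
- by move=> s; rewrite /= in_itv/= => sx; exact: convolved_le.
Qed.

Definition box_approx (a : nat -> R -> X) (n : nat) (s : R) : X :=
  if s \in `[- n%:R, n%:R]%classic then a n s else 0.

Lemma box_approx_finite_valued (a : nat -> R -> X) n : finite_valued (a n) ->
  finite_valued (box_approx a n).
Proof.
move=> fa; apply: finite_valued_if => //; last exact: finite_valued_cst.
exact: leb_measurable_itv.
Qed.

Definition trunc_convolution (a : nat -> R -> X) (n : nat) (x : R) : Y :=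
  bochner setT (fun s => truncT T n (x - s) (box_approx a n s)).

Lemma truncT_strongly_measurable n x (h : R -> X) : strongly_measurable setT h ->
  strongly_measurable setT (fun s => truncT T n (x - s) (h s)).
Proof.
move=> mh; apply: (strongly_measurable_op (K := fun s v => truncT T n (x - s) v)) => //.
- exact: openT.
- move=> v s _; apply: (@continuous_comp _ _ _ (fun s => x - s) (fun r => truncT T n r v)).
    by apply: cvgB; [exact: cvg_cst|exact: cvg_id].
  exact: truncT_continuous.
- by move=> s _; exact: truncT_seq_continuous.
Qed.

(** Continuity of the truncated convolution, in sequential form: the integrand
    is continuous in x and dominated by a constant on a bounded interval. *)
Lemma trunc_convolution_cvg (a : nat -> R -> X) n (u : nat -> R) (x : R) : finite_valued (a n) ->
  u k @[k --> \oo] --> x ->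
  trunc_convolution a n (u k) @[k --> \oo] --> trunc_convolution a n x.
Proof.
move=> fa ux; have fb := box_approx_finite_valued fa.
have [C hC] := truncT_bounded_finite_valued T_sc n fa.
have C0 : 0 <= C := le_trans (rnorm_ge0 _) (hC 0 0).
pose w (s : R) := if s \in `[- n%:R, n%:R]%classic then C else 0.
have mw : leb_measurable setT (fun s => (w s)%:E).
  apply: (@finite_valued_measurable _ _ w EFin); apply: finite_valued_if; last 2 first.
  - exact: finite_valued_cst.
  - exact: finite_valued_cst.
  exact: leb_measurable_itv.
have bw r s : rnorm (truncT T n r (box_approx a n s)) <= w s.
  rewrite /box_approx /w; case: ifP => _; first exact: hC.
  by rewrite truncT0 rnorm0.
apply: (bochner_dominated_cvg (w := w)) => //.
- exact: measurableT.
- move=> k; apply: truncT_strongly_measurable; exact: finite_valued_strongly_measurable.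
- apply: truncT_strongly_measurable; exact: finite_valued_strongly_measurable.
- apply: (@le_lt_trans _ _ (leb_int `[- n%:R, n%:R] (fun=> C%:E))).
    rewrite /leb_int (@integral_mkcond _ (lebesgueR R) R mu `[- n%:R, n%:R]%classic).
    apply: leb_int_mono => s _; first by rewrite lee_fin /w; case: ifP.
    by rewrite patchE /w; case: ifP.
  rewrite /leb_int (@integral_cst _ (lebesgueR R) R mu _ (leb_measurable_itv _)).
  rewrite [mu _]lebesgue_measure_itv/=; case: ifP => _; first by rewrite -EFinD -EFinM ltry.
  by rewrite mule0.
- apply: leb_aeW => s _.
  apply: (@continuous_cvg _ _ _ _ _ _ (fun r => truncT T n r (box_approx a n s))).
    exact: truncT_continuous.
  by apply: cvgB => //; exact: cvg_cst.
Qed.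

(** The weight ||T(x-s)|| |g(s)| is integrable for each x separately, which
    gives convergence at every x but in general not locally uniformly. *)
Lemma trunc_convolution_cvg_convolution (a : nat -> R -> X) x :
  dominated_approx setT g a ->
  trunc_convolution a n x @[n --> \oo] --> convolution T g x.
Proof.
move=> [fa ag ale _].
have mI : leb_measurable_set (`]-oo, x[ : set R) by exact: leb_measurable_itv.
have mi := strongly_measurable_convolved x g_meas.
rewrite /convolution -bochner_patch//; last first.
  apply: le_lt_trans (Tg_int x); apply: leb_int_mono => s; rewrite /= in_itv/= => sx.
    by rewrite lee_fin rnorm_ge0.
  by rewrite lee_fin convolved_le.
pose w s := if s \in `]-oo, x[%classic then opnorm (T (x - s)) * (2 * rnorm (g s)) else 0.
have op0 s : 0 <= opnorm (T (x - s)) by exact: opnorm_ge0.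
have mg : leb_measurable setT (fun s => (rnorm (g s))%:E).
  by apply: strongly_measurable_norm => //; exact: measurableT.
have mg2 : leb_measurable setT (fun s => (2 * rnorm (g s))%:E).
  by apply/measurable_EFinP; apply: measurable_funM; [exact: measurable_cst|exact/measurable_EFinP].
have wE : (fun s => (w s)%:E) =
    patch (fun=> 0%E) `]-oo, x[ (fun s => (opnorm (T (x - s)) * (2 * rnorm (g s)))%:E).
  by apply/funext => s; rewrite patchE /w; case: ifP.
have ale2 n s : rnorm (box_approx a n s) <= 2 * rnorm (g s).
  rewrite /box_approx; case: ifP => _; last by rewrite rnorm0 mulr_ge0// rnorm_ge0.
  have := ale n s I; have := rnorm_sub_le (a n s) (g s); rewrite rnormBC; lra.
apply: (bochner_dominated_cvg (w := w)) => //.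
- exact: measurableT.
- move=> k; apply: truncT_strongly_measurable; apply: finite_valued_strongly_measurable.
  exact: box_approx_finite_valued.
- exact: strongly_measurable_patch.
- rewrite wE; apply/(@measurable_restrictT _ _ (lebesgueR R) _ _ _ mI).
  exact: weight_measurable.
- rewrite wE /leb_int -(@integral_mkcond _ (lebesgueR R) R mu).
  apply: (@le_lt_trans _ _ (leb_int `]-oo, x[ (fun s => (opnorm (T (x - s)) * rnorm (g s))%:E
     + (opnorm (T (x - s)) * rnorm (g s))%:E)%E)).
    apply: leb_int_mono => s; rewrite /= in_itv/= => sx.
      by rewrite lee_fin mulr_ge0 ?op0// mulr_ge0// rnorm_ge0.
    rewrite -EFinD lee_fin; lra.
  rewrite leb_intD//; first exact: lte_add_pinfty.
  - exact: weight_measurable.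
  - exact: weight_measurable.
  - by move=> s _; rewrite lee_fin mulr_ge0 ?op0// rnorm_ge0.
  - by move=> s _; rewrite lee_fin mulr_ge0 ?op0// rnorm_ge0.
- move=> n s _; rewrite /w; case: ifPn => [|]; rewrite ?inE ?notin_setE/= in_itv/=.
    move=> sx; apply: (le_trans (truncT_le T_sc _ _ _)); first by rewrite subr_gt0.
    by rewrite ler_wpM2l ?op0.
  by move/negP; rewrite -leNgt => xs; rewrite truncT_le0 ?rnorm0// subr_le0.
- move=> s _; rewrite /w; case: ifPn => [|]; rewrite ?rnorm0// inE/= in_itv/= => sx.
  apply: (le_trans (convolved_le _ sx)); rewrite ler_wpM2l ?op0//.
  have := rnorm_ge0 (g s); lra.
- apply: leb_aeS ag => s /(_ I) ag _; case: ifPn => [|]; rewrite ?inE ?notin_setE/= in_itv/=.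
    move=> sx.
    have h1 : T (x - s) (a n s) @[n --> \oo] --> T (x - s) (g s).
      by apply: bounded_op_seq_continuous => //; apply: T_sc.1; rewrite subr_gt0.
    apply: cvg_trans h1; apply: near_eq_cvg.
    have xs0 : 0 < x - s by rewrite subr_gt0.
    have : \forall n \near \oo, `|s| <= n%:R by exact: nbhs_infty_ger.
    move=> hs; near=> n.
    have -> : box_approx a n s = a n s.
      rewrite /box_approx mem_set//= in_itv/= -ler_norml; near: n; exact: hs.
    have [h|[_ h]] := cutoff_clip n (x - s).
      have : cutoff n (x - s) = 1 /\ clip n (x - s) = x - s.
        near: n; exact: cutoff_clip_near.
      by rewrite h => -[/eqP]; rewrite eq_sym oner_eq0.
    rewrite /truncT h.
    have [-> _] : cutoff n (x - s) = 1 /\ clip n (x - s) = x - s.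
      near: n; exact: cutoff_clip_near.
    by rewrite scale1r.
  move/negP; rewrite -leNgt => xs.
  rewrite (_ : (fun n => _) = fun=> 0); first exact: cvg_cst.
  by apply/funext => n; rewrite truncT_le0// subr_le0.
Unshelve. all: by end_near. Qed.

(** The convolution is a pointwise limit of continuous functions, although it
    need not be continuous itself. *)
Lemma convolution_diff_measurable tau :
  leb_measurable setT (fun x => (diff_norm (convolution T g) tau x)%:E).
Proof.
have [a ga] := strongly_measurable_approx measurableT g_meas.
apply: (@leb_measurable_cvg _ _ (fun n x =>
   (rnorm (trunc_convolution a n (x + tau) - trunc_convolution a n x))%:E)); last first.
  apply: leb_aeW => x _; apply: cvg_EFin; first exact: nearW.
  by apply: cvg_rnorm; apply: cvgB; exact: trunc_convolution_cvg_convolution.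
move=> n; have fa : finite_valued (a n) by case: ga.
pose N (x : R) : R := rnorm (trunc_convolution a n (x + tau) - trunc_convolution a n x).
suff cN : continuous N.
  have h : measurable_fun setT N by exact: continuous_measurable_fun.
  apply/measurable_EFinP => _ B mB; apply: leb_measurable_borel; exact: h.
move=> x; apply/(@cvg_nbhsP _ R^o) => u ux.
apply: cvg_rnorm; apply: cvgB; last exact: trunc_convolution_cvg.
by apply: trunc_convolution_cvg => //; apply: cvgD => //; exact: cvg_cst.
Qed.

End ConvolutionMeasurability.

(** * Luxemburg norms and the Hoelder inequality *)

Section VariableExponentTheory.
Variable R : realType.
Local Notation mu := (leb R).
Local Open Scope ereal_scope.

Lemma varphi_ge0 (p t : \bar R) : 0 <= varphi p t.
Proof. by rewrite /varphi; case: ifP => _; [case: ifP|exact: poweR_ge0]. Qed.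

Lemma exponent_cases (p : \bar R) : 1 <= p ->
  p = +oo \/ exists2 r : R, (1 <= r)%R & p = r%:E.
Proof.
by case: p => [r r1|_|//]; [right; exists r; rewrite // -lee_fin|left].
Qed.

Lemma varphi_mono (p s t : \bar R) : 1 <= p -> 0 <= s -> s <= t ->
  varphi p s <= varphi p t.
Proof.
move=> /exponent_cases[->|[r r1 ->]] s0 st; rewrite /varphi ?eqxx /=.
  case: ifPn => [_|s1]; first by case: ifP.
  case: ifPn => // t1; move: s1; by rewrite (le_trans st t1).
apply: gt0_ler_poweR => //; first exact: le_trans r1.
  by rewrite in_itv/= s0 leey.
by rewrite in_itv/= (le_trans s0 st) leey.
Qed.

(** Convexity of the modular at 0, uniformly in the exponent. *)
Lemma varphi_scale_le (p : \bar R) (c t : R) : 1 <= p -> (0 <= c)%R -> (c <= 1)%R -> (0 <= t)%R ->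
  varphi p (c * t)%:E <= c%:E * varphi p t%:E.
Proof.
move=> /exponent_cases[->|[r r1 ->]] c0 c1 t0; rewrite /varphi ?eqxx /= ?lee_fin.
  case: ifPn => ct; first by apply: mule_ge0; [rewrite lee_fin|case: ifP].
  rewrite ifF; last first.
    apply/negbTE; rewrite -ltNge; move: ct; rewrite -ltNge => /lt_le_trans; apply.
    exact: ler_piMl.
  rewrite gt0_muley// lte_fin lt_def c0 andbT; apply: contraNN ct => /eqP ->; by rewrite mul0r ler01.
rewrite powRM//  -?EFinM ?lee_fin ler_wpM2r ?powR_ge0//.
have [->|cn0] := eqVneq c 0%R; first by rewrite powR0// gt_eqF// (lt_le_trans _ r1).
rewrite -[leRHS]powRr1//; apply: ger_powR => //.
by rewrite lt_def cn0 c0 c1.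
Qed.

(** Young's inequality with its constants 1/p and 1/q enlarged to 1, so that the
    extreme exponents 1 and +oo fit the same statement. *)
Lemma varphi_young (p q : \bar R) (a b : R) : 1 <= p -> 1 <= q -> p^-1 + q^-1 = 1 ->
  (0 <= a)%R -> (0 <= b)%R -> (a * b)%:E <= varphi p a%:E + varphi q b%:E.
Proof.
have infty_one (x y : R) (r s : \bar R) : (0 <= x)%R -> (0 <= y)%R -> r = +oo -> s = 1 ->
    (x * y)%:E <= varphi r x%:E + varphi s y%:E.
  move=> x0 y0 -> ->; rewrite /varphi /= lee_fin powRr1//.
  case: ifPn => [x1|_]; last by rewrite addye// leey.
  by rewrite add0e lee_fin ler_piMl.
move=> p1 q1 pq a0 b0.
case: (exponent_cases p1) => [pE|[r r1 pE]].
  apply: infty_one => //; move: pq; rewrite pE invey add0e => /eqP.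
  by rewrite inve_eq1 => /eqP.
case: (exponent_cases q1) => [qE|[s s1 qE]].
  rewrite mulrC addeC; apply: infty_one => //; move: pq; rewrite qE invey adde0 => /eqP.
  by rewrite inve_eq1 => /eqP.
have r0 : (0 < r)%R by exact: lt_le_trans r1.
have s0 : (0 < s)%R by exact: lt_le_trans s1.
move: pq; rewrite pE qE !inver !gt_eqF// -EFinD => -[rs].
rewrite /varphi /= -EFinD lee_fin.
apply: (le_trans (conjugate_powR a0 b0 r0 s0 rs)).
by apply: lerD; rewrite ler_piMr ?powR_ge0// invf_le1.
Qed.

Lemma varphi_measurable (p : R -> \bar R) (D : set R) (u : R -> R) :
  exponent p -> leb_measurable_set D -> leb_measurable D (fun x => (u x)%:E) ->
  leb_measurable D (fun x => varphi (p x) (u x)%:E).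
Proof.
move=> [mp p1] mD /measurable_EFinP mu_.
apply: (@leb_measurable_ext _ _ (fun x => if p x == +oo then
    (if (u x <= 1)%R then 0 else +oo)
    else if (u x == 0)%R then 0 else (expR (fine (p x) * ln (u x)))%:E)).
  move=> x _; rewrite /varphi lee_fin.
  have [-> //|[r r1 ->]] := exponent_cases (p1 x).
  rewrite /= /powR; case: ifP => _ //.
  by rewrite (_ : (r == 0)%R = false)//; apply/negbTE; rewrite gt_eqF// (lt_le_trans _ r1).
have mp' : leb_measurable D p by exact: (leb_measurableS measurableT (@subsetT _ D) mp).
have mc (c : \bar R) : leb_measurable D (fun=> c) by exact: measurable_cst.
apply: leb_measurable_if => //.
- rewrite (_ : D `&` _ = D `&` p @^-1` [set +oo]).
    exact: (mp' mD _ (emeasurable_set1 _)).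
  by apply/seteqP; split=> x /= [Dx] => [/eqP|->].
- apply: leb_measurable_if => //.
  rewrite (_ : D `&` _ = D `&` (EFin \o u) @^-1` `]-oo, 1%:E]).
    exact: ((measurable_EFinP _ _).2 mu_ mD _ (emeasurable_itv _)).
  by apply/seteqP; split=> x /= [Dx]; rewrite in_itv/= lee_fin.
- apply: leb_measurable_if => //.
    rewrite (_ : D `&` _ = D `&` u @^-1` [set 0%R]).
      exact: (mu_ mD _ (measurable_set1 _)).
    by apply/seteqP; split=> x /= [Dx] => [/eqP|->].
  apply/measurable_EFinP; apply: (measurableT_comp (@measurable_expR R)).
  apply: measurable_funM.
    exact: (measurableT_comp (@fine_measurable R setT measurableT) mp').
  exact: (measurableT_comp (@measurable_ln R) mu_).
Qed.

Lemma Lp_norm_le (p : R -> \bar R) (D : set R) (u : R -> R) (lam : R) : (0 < lam)%R ->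
  leb_int D (fun x => varphi (p x) (u x / lam)%:E) <= 1 -> Lp_norm p D u <= lam%:E.
Proof. by move=> l0 h; apply: ereal_inf_lbound; exists lam. Qed.

Lemma Lp_norm_ge0 (p : R -> \bar R) (D : set R) (u : R -> R) : 0 <= Lp_norm p D u.
Proof. by apply: le_ereal_inf_tmp => _ [lam [l0 _] <-]; rewrite lee_fin ltW. Qed.

(** Shrinking the argument by a factor c <= 1 multiplies the modular by at most
    c, so a finite modular can be brought below 1. *)
Lemma Lp_norm_lty (p : R -> \bar R) (D : set R) (u : R -> R) : exponent p ->
  leb_measurable_set D -> (forall x, (0 <= u x)%R) -> in_Lp p D u -> Lp_norm p D u < +oo.
Proof.
move=> ep mD u0 [mu_ [lam l0]].
set M := leb_int _ _ => Moo.
have M0 : 0 <= M by apply: leb_int_ge0 => x _; exact: varphi_ge0.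
have Mfin : M \is a fin_num by rewrite ge0_fin_numE.
have fM0 : (0 <= fine M)%R by exact: fine_ge0.
(* small enough for c * M <= 1 and c <= 1 *)
pose c := ((fine M + 1)^-1)%R.
have c0 : (0 < c)%R by rewrite invr_gt0; lra.
have c1 : (c <= 1)%R by rewrite invf_le1; lra.
apply: (@le_lt_trans _ _ ((c * lam)^-1)%:E); last exact: ltry.
apply: Lp_norm_le; first by rewrite invr_gt0 mulr_gt0.
apply: (@le_trans _ _ (leb_int D (fun x => c%:E * varphi (p x) (lam * u x)%:E))).
  apply: leb_int_mono => x _; first exact: varphi_ge0.
  rewrite invrK; have -> : (u x * (c * lam) = c * (lam * u x))%R by ring.
  apply: varphi_scale_le => //; [exact: ep.2|exact: ltW|exact: mulr_ge0 (ltW l0) (u0 x)].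
rewrite leb_intZl; first 1 last.
- exact: mD.
- apply: varphi_measurable; [exact: ep|exact: mD|].
  apply/measurable_EFinP; apply: measurable_funM; first exact: measurable_cst.
  exact/measurable_EFinP.
- by move=> x _; exact: varphi_ge0.
- exact: ltW.
rewrite -/M -(fineK Mfin) -EFinM lee_fin.
by rewrite /c mulrC ler_pdivrMr ?mul1r; lra.
Qed.

(** The infima are taken one at a time, and the case of a vanishing infimum is
    treated apart since one then cannot divide by it. *)
Lemma inf_mul_ge (P Q : set R) (I : \bar R) : 0 <= I ->
  (forall al be : R, (0 < al)%R -> (0 < be)%R -> Q al -> P be -> I <= (2 * al * be)%:E) ->
  let A := ereal_inf [set al%:E | al in [set al : R | (0 < al)%R /\ Q al]] in
  let B := ereal_inf [set be%:E | be in [set be : R | (0 < be)%R /\ P be]] in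
  A < +oo -> B < +oo -> I <= 2%:E * A * B.
Proof.
move=> I0 key A B aoo boo.
have [_ [al1 [al10 ha1] <-] _] := ereal_inf_lt aoo.
have [_ [be1 [be10 hb1] <-] _] := ereal_inf_lt boo.
have A0 : 0 <= A by apply: le_ereal_inf_tmp => _ [al [al0 _] <-]; rewrite lee_fin ltW.
have B0 : 0 <= B by apply: le_ereal_inf_tmp => _ [be [be0 _] <-]; rewrite lee_fin ltW.
have lA (c : R) : (forall al, (0 < al)%R -> Q al -> (c <= al)%R) -> c%:E <= A.
  by move=> h; apply: le_ereal_inf_tmp => _ [al [al0 ha] <-]; rewrite lee_fin h.
have lB (c : R) : (forall be, (0 < be)%R -> P be -> (c <= be)%R) -> c%:E <= B.
  by move=> h; apply: le_ereal_inf_tmp => _ [be [be0 hb] <-]; rewrite lee_fin h.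
clearbody A B.
case: A aoo A0 lA => [a _ a0 lA|//|//]; case: B boo B0 lB => [b _ b0 lB|//|//].
have Ifin : I \is a fin_num.
  rewrite (ge0_fin_numE I0).
  by apply: (le_lt_trans (key _ _ al10 be10 ha1 hb1)); exact: ltry.
rewrite -(fineK Ifin) in key *; move: (fine I) key => i key.
rewrite !lee_fin in a0 b0.
have step1 (be : R) : (0 < be)%R -> P be -> (i <= 2 * a * be)%R.
  move=> be0 hb; have : (i / (2 * be))%:E <= a%:E.
    apply: lA => al al0 ha; rewrite ler_pdivrMr ?mulr_gt0//.
    by have := key _ _ al0 be0 ha hb; rewrite lee_fin; lra.
  rewrite lee_fin ler_pdivrMr ?mulr_gt0//; lra.
rewrite -!EFinM lee_fin; have [a00|an0] := eqVneq a 0%R.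
  by have := step1 _ be10 hb1; rewrite a00 !mulr0 !mul0r.
have ap : (0 < a)%R by rewrite lt_def an0.
have : (i / (2 * a))%:E <= b%:E.
  apply: lB => be be0 hb; rewrite ler_pdivrMr ?mulr_gt0//.
  have := step1 _ be0 hb; lra.
rewrite lee_fin ler_pdivrMr ?mulr_gt0//; lra.
Qed.

(** Scale a and b by admissible constants, integrate Young's inequality, and let
    the constants decrease to the norms. The constant 2 is the sum of the two
    modulars, and it is the factor 2 in the hypothesis on Sigma. *)
Lemma Lp_holder (p q : R -> \bar R) (D : set R) (a b : R -> R) :
  exponent p -> exponent q -> (forall x, (p x)^-1 + (q x)^-1 = 1) ->
  leb_measurable_set D ->
  leb_measurable D (fun x => (a x)%:E) -> leb_measurable D (fun x => (b x)%:E) ->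
  (forall x, D x -> (0 <= a x)%R) -> (forall x, D x -> (0 <= b x)%R) ->
  Lp_norm q D a < +oo -> Lp_norm p D b < +oo ->
  leb_int D (fun x => (a x * b x)%:E) <= 2%:E * Lp_norm q D a * Lp_norm p D b.
Proof.
move=> ep eq pq mD ma mb a0 b0 aoo boo.
set I := leb_int _ _.
have I0 : 0 <= I.
  by apply: leb_int_ge0 => x Dx; rewrite lee_fin mulr_ge0 ?a0 ?b0.
have mscale (u : R -> R) (c : R) : leb_measurable D (fun x => (u x)%:E) ->
    leb_measurable D (fun x => (u x / c)%:E).
  move=> /measurable_EFinP mu_; apply/measurable_EFinP; apply: (measurable_funM mu_).
  exact: measurable_cst.
have key (al be : R) : (0 < al)%R -> (0 < be)%R ->
    leb_int D (fun x => varphi (q x) (a x / al)%:E) <= 1 ->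
    leb_int D (fun x => varphi (p x) (b x / be)%:E) <= 1 ->
    I <= (2 * al * be)%:E.
  move=> al0 be0 ha hb.
  apply: (@le_trans _ _ (leb_int D (fun x => (al * be)%:E *
      (varphi (q x) (a x / al)%:E + varphi (p x) (b x / be)%:E)))).
    apply: leb_int_mono => x Dx; first by rewrite lee_fin mulr_ge0 ?a0 ?b0.
    have -> : (a x * b x = (al * be) * ((a x / al) * (b x / be)))%R.
      by field; rewrite !gt_eqF.
    rewrite EFinM; apply: lee_wpmul2l; first by rewrite lee_fin mulr_ge0// ltW.
    apply: varphi_young; [exact: eq.2|exact: ep.2|by rewrite addeC| |].
      by rewrite divr_ge0 ?a0// ltW.
    by rewrite divr_ge0 ?b0// ltW.
  have m1 := varphi_measurable eq mD (mscale _ al ma).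
  have m2 := varphi_measurable ep mD (mscale _ be mb).
  rewrite leb_intZl; first 1 last.
  - exact: mD.
  - exact: (emeasurable_funD m1 m2).
  - by move=> x _; apply: adde_ge0; exact: varphi_ge0.
  - by rewrite mulr_ge0// ltW.
  rewrite (_ : (2 * al * be = (al * be) * 2)%R); last by ring.
  rewrite [leRHS]EFinM; apply: lee_wpmul2l; first by rewrite lee_fin mulr_ge0// ltW.
  rewrite (leb_intD mD m1 m2); try by move=> x _; exact: varphi_ge0.
  have -> : 2%:E = 1 + 1 :> \bar R by rewrite -EFinD.
  exact: leeD ha hb.
exact: (inf_mul_ge I0 key aoo boo).
Qed.

End VariableExponentTheory.

(** * Differences of the convolution *)

Section ReflectedConvolution.
Variables (R : realType) (X Y : completeNormedModType R[i]).
Variables (T : R -> {linear X -> Y}) (g : R -> X).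
Local Notation mu := (leb R).
Local Notation rg := (reflect_fun g).
Hypothesis T_sc : strongly_continuous T.
Hypothesis rg_meas : strongly_measurable setT rg.
Hypothesis Trg_int : forall x : R, (leb_int `](- x)%R, +oo[
   (fun v => (opnorm (T (v + x)) * rnorm (rg v))%R%:E) < +oo)%E.

Lemma reflect_funK : rg \o flip 0 = g.
Proof. by apply/funext => s; rewrite /= /reflect_fun /flip sub0r opprK. Qed.

Lemma strongly_measurable_unreflect : strongly_measurable setT g.
Proof. by rewrite -reflect_funK -(preimage_setT (flip 0)); exact: strongly_measurable_flip. Qed.

Lemma flip_ray (c d : R) : flip c @^-1` `]-oo, d[ = `](c - d), +oo[%classic.
Proof. by apply/seteqP; split=> s /=; rewrite !in_itv/= andbT /flip; lra. Qed.

Lemma opnorm_shift_measurable x :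
  leb_measurable `[- x, +oo[ (fun v => (opnorm (T (v + x)))%:E).
Proof.
have -> : `[- x, +oo[%classic = [set - x] `|` `](- x), +oo[%classic.
  apply/seteqP; split=> v /=; rewrite !in_itv/= !andbT.
    by rewrite le_eqVlt => /orP[/eqP ->|]; [left|right].
  by case=> [->//|/ltW].
have m1 : leb_measurable_set [set - x].
  by apply: leb_measurable_borel; exact: measurable_set1.
apply/(measurable_funU (T1 := lebesgueR R) _ m1 (leb_measurable_itv _)); split.
  exact: measurable_fun_set1.
have := @leb_measurable_flip _ 0 _ _ (opnorm_flip_measurable (x := x) T_sc).
rewrite flip_ray sub0r; apply: leb_measurable_ext => v _.
by rewrite /= /flip sub0r opprK addrC.
Qed.

Lemma convolution_weight_lty x : (leb_int `]-oo, x[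
   (fun s => (opnorm (T (x - s)) * rnorm (g s))%:E) < +oo)%E.
Proof.
have mg : leb_measurable setT (fun s => (rnorm (g s))%:E).
  by apply: strongly_measurable_norm; [exact: measurableT|exact: strongly_measurable_unreflect].
rewrite (leb_int_flip 0).
- rewrite flip_ray sub0r; apply: le_lt_trans (Trg_int x).
  rewrite le_eqVlt; apply/orP; left; apply/eqP; apply: leb_int_ext => v _.
  by rewrite /= /flip sub0r opprK addrC.
- exact: leb_measurable_itv.
- exact: weight_measurable.
- by move=> s _; rewrite lee_fin mulr_ge0 ?opnorm_ge0 ?rnorm_ge0.
Qed.

Lemma convolution_integrable_of_reflected : convolution_integrable T g.
Proof.
apply: convolution_integrable_of_weight => //.
  exact: strongly_measurable_unreflect.
exact: convolution_weight_lty.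
Qed.

(** Reflecting about tau moves both G(x + tau) and, for tau = 0, G(x) to
    integrals over the same ray with the same operators, so that they can be
    subtracted. *)
Lemma convolution_shift x tau :
  bochner_integrable `](- x), +oo[ (fun v => T (v + x) (rg (v - tau))) /\
  convolution T g (x + tau) = bochner `](- x), +oo[ (fun v => T (v + x) (rg (v - tau))).
Proof.
have mI : leb_measurable_set (`]-oo, (x + tau)[ : set R) by exact: leb_measurable_itv.
have [h1 h2] := bochner_flip tau mI (convolution_integrable_of_reflected (x + tau)).
have DE : flip tau @^-1` `]-oo, (x + tau)[ = `](- x), +oo[%classic.
  rewrite flip_ray (_ : tau - (x + tau) = - x)//; ring.
have fE : (fun s => T (x + tau - s) (g s)) \o flip tau = fun v => T (v + x) (rg (v - tau)).
  apply/funext => v; rewrite /= /flip /reflect_fun (opprB v tau).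
  by rewrite (_ : x + tau - (tau - v) = v + x)//; ring.
move: h1 h2; rewrite DE fE => h1 h2; exact: (conj h1 (esym h2)).
Qed.

(** A period tau of the convolution corresponds to the period -tau of the
    reflected function. *)
Lemma convolution_diff_le x tau :
  ((diff_norm (convolution T g) tau x)%:E <= leb_int `](- x)%R, +oo[
    (fun v => (opnorm (T (v + x)) * diff_norm rg (- tau) v)%R%:E))%E.
Proof.
have [i1 e1] := convolution_shift x tau; have [i0 e0] := convolution_shift x 0.
rewrite addr0 in e0; rewrite /diff_norm e1 e0.
apply: (le_trans (bochner_dist_le (leb_measurable_itv _) i1 i0)).
apply: leb_int_mono => v; rewrite /= in_itv/= andbT => xv; first by rewrite lee_fin rnorm_ge0.
rewrite lee_fin -linearB subr0; apply: opnorm_le; apply: T_sc.1; lra.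
Qed.

End ReflectedConvolution.

(** * The bound by Sigma *)

(** Trades the norm P for the weighted norm w * P, which is the quantity
    controlled by almost periodicity. *)
Lemma weighted_product_le (R : realType) (Q P S : \bar R) (w : R) :
  (0 <= Q)%E -> (0 <= P)%E -> (P < +oo)%E -> 0 < w -> ((w * fine P)%:E <= S)%E ->
  (2%:E * Q * P <= 2%:E * (Q * (w^-1)%:E * S))%E.
Proof.
move=> Q0 P0 Poo w0 wPS; rewrite -!muleA.
apply: lee_wpmul2l; first by rewrite lee_fin.
apply: lee_wpmul2l => //.
have Pfin : P \is a fin_num by rewrite ge0_fin_numE.
have -> : P = ((w^-1)%:E * (w * fine P)%:E)%E.
  by rewrite -EFinM mulKf ?fineK// gt_eqF.
by apply: lee_wpmul2l => //; rewrite lee_fin invr_ge0 ltW.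
Qed.

Section SigmaBound.
Variables (R : realType) (X Y : completeNormedModType R[i]).
Variables (T : R -> {linear X -> Y}) (g : R -> X).
Local Notation mu := (leb R).
Local Notation rg := (reflect_fun g).
Hypothesis T_sc : strongly_continuous T.
Hypothesis rg_meas : strongly_measurable setT rg.
Hypothesis Trg_int : forall x : R, (leb_int `](- x)%R, +oo[
   (fun v => (opnorm (T (v + x)) * rnorm (rg v))%R%:E) < +oo)%E.

Variables (p q : R -> \bar R) (F : R -> R -> R).
Hypothesis F_gt0 : forall l t : R, 0 < l -> 0 < F l t.
Hypothesis p_exp : exponent p.
Hypothesis q_exp : exponent q.
Hypothesis pq : forall x : R, ((p x)^-1 + (q x)^-1 = 1)%E.

(** The ray is cut into intervals of length l, and the Hoelder inequality on the
    k-th one gives the k-th term of Sigma. *)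
Lemma convolution_diff_le_Sigma (x tau l : R) (S : \bar R) : 0 < l ->
  (Sigma T q F l x < +oo)%E -> diff_Lploc p rg (- tau) ->
  (forall t, (F l t * fine (Lp_norm p `[t, t + l] (diff_norm rg (- tau))))%:E <= S)%E ->
  ((diff_norm (convolution T g) tau x)%:E <= 2%:E * Sigma T q F l x * S)%E.
Proof.
move=> l0 Soo du hS.
set u := diff_norm rg (- tau) in hS *.
have u0 v : 0 <= u v by exact: rnorm_ge0.
pose a v := opnorm (T (v + x)).
have a0 v : 0 <= a v by exact: opnorm_ge0.
have au0 v : (0 <= (a v * u v)%:E)%E by rewrite lee_fin; apply: mulr_ge0; [exact: a0|exact: u0].
pose I k := `[(- x + k%:R * l), (- x + k.+1%:R * l)]%classic.
pose J k := `[(- x + k%:R * l), (- x + k.+1%:R * l)[%classic.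
pose c k := (Lp_norm q (I k) a * ((F l (- x + k%:R * l))^-1)%:E)%E.
have SE : Sigma T q F l x = (\sum_(0 <= k <oo) c k)%E by [].
have c0 k : (0 <= c k)%E.
  by apply: mule_ge0; [exact: Lp_norm_ge0|rewrite lee_fin invr_ge0 ltW// F_gt0].
have S0 : (0 <= S)%E.
  apply: le_trans (hS 0); rewrite lee_fin mulr_ge0 ?fine_ge0 ?Lp_norm_ge0//.
  by rewrite ltW// F_gt0.
have mu_ : leb_measurable setT (fun v => (u v)%:E).
  apply: (@leb_measurable_ext _ _ (fun v => (rnorm (rg (flip 0 (flip tau v)) - rg v))%:E)).
    by move=> v _; rewrite /u /diff_norm /flip (_ : 0 - (tau - v) = v - tau)//; ring.
  apply: strongly_measurable_norm; first exact: measurableT.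
  apply: strongly_measurableB => //.
  rewrite -(preimage_setT (flip tau)).
  apply: (@strongly_measurable_flip _ _ _ _ (rg \o flip 0)).
  by rewrite -(preimage_setT (flip 0)); exact: strongly_measurable_flip.
have mI k : leb_measurable_set (I k) by exact: leb_measurable_itv.
have Ia k : I k `<=` `[- x, +oo[.
  move=> v; rewrite /I /= !in_itv/= andbT => /andP[+ _]; apply: le_trans.
  by rewrite lerDl mulr_ge0// ltW.
have mray : leb_measurable_set (`[- x, +oo[ : set R) by exact: leb_measurable_itv.
have maI k : leb_measurable (I k) (fun v => (a v)%:E).
  exact: (leb_measurableS mray (@Ia k) (@opnorm_shift_measurable _ _ _ _ T_sc x)).
have mau : leb_measurable `[- x, +oo[ (fun v => (a v * u v)%:E).
  apply/measurable_EFinP; apply: measurable_funM.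
    by exact/measurable_EFinP/opnorm_shift_measurable.
  by apply/measurable_EFinP; exact: (leb_measurableS measurableT (@subsetT _ _) mu_).
have term k : (leb_int (I k) (fun v => (a v * u v)%:E) <= 2%:E * (c k * S))%E.
  have Foo : 0 < F l (- x + k%:R * l) by exact: F_gt0.
  have coo : (c k < +oo)%E.
    apply: le_lt_trans Soo; rewrite SE (nneseriesD1 (n := k))//.
    by rewrite leeDl//; apply: nneseries_ge0.
  have Qoo : (Lp_norm q (I k) a < +oo)%E.
    move: coo; rewrite /c; case: (Lp_norm _ _ _) => [r _||//]; first exact: ltry.
    by rewrite gt0_mulye ?lte_fin ?invr_gt0.
  have Poo : (Lp_norm p (I k) u < +oo)%E.
    apply: Lp_norm_lty => //; exact: du (@segment_compact _ _ _).
  have Q0 := Lp_norm_ge0 q (I k) a; have P0 := Lp_norm_ge0 p (I k) u.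
  have mul_ : leb_measurable (I k) (fun v => (u v)%:E).
    exact: (leb_measurableS measurableT (@subsetT _ _) mu_).
  apply: (le_trans (Lp_holder p_exp q_exp pq (mI k) (maI k) mul_ _ _ Qoo Poo)) => //.
  apply: (weighted_product_le Q0 P0 Poo Foo).
  have := hS (- x + k%:R * l).
  have -> : - x + k%:R * l + l = - x + k.+1%:R * l by rewrite mulrS; ring.
  exact.
apply: (le_trans (convolution_diff_le T_sc rg_meas Trg_int x tau)).
have JE : \bigcup_k J k = `[- x, +oo[%classic.
  apply/seteqP; split=> [v [k _]|v].
    by rewrite /J /= => vJ; apply: (Ia k); rewrite /I /=; apply: subset_itv_co_cc vJ.
  rewrite /= in_itv/= andbT => xv.
  have /truncn_itv/andP[h1 h2] : 0 <= (v + x) / l by apply: divr_ge0; [lra|exact: ltW].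
  exists (Num.truncn ((v + x) / l)) => //; rewrite /J /= in_itv/=.
  rewrite ler_pdivlMr// in h1; rewrite ltr_pdivrMr// in h2.
  by apply/andP; split; lra.
apply: (@le_trans _ _ (leb_int `[- x, +oo[ (fun v => (a v * u v)%:E))).
  apply: leb_int_subset => [v _|]; first exact: au0.
  by move=> v; rewrite /= !in_itv/= !andbT => /ltW.
rewrite -JE /leb_int (@ge0_integral_bigcup _ (lebesgueR R) R mu); last 4 first.
- by move=> k; exact: leb_measurable_itv.
- by rewrite JE.
- by move=> v _; exact: au0.
- move=> i j _ _ [v]; rewrite /J /= !in_itv/= => -[/andP[i1 i2] /andP[j1 j2]].
  have lt_ (m n : nat) : - x + m%:R * l <= v -> v < - x + n.+1%:R * l -> (m <= n)%N.
    move=> h1 h2; rewrite -ltnS -(@ltr_nat R) -(ltr_pM2r l0); lra.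
  by apply/eqP; rewrite eqn_leq !lt_.
apply: (@le_trans _ _ (\sum_(0 <= k <oo) (2%:E * (c k * S))%E)%E).
  apply: lee_nneseries => [k _ _|k _]; first by apply: leb_int_ge0 => v _; exact: au0.
  apply: le_trans (term k); apply: leb_int_subset => [v _|v]; first exact: au0.
  by rewrite /J /I /=; apply: subset_itv_co_cc.
rewrite nneseriesZl; last by move=> k _; exact: mule_ge0.
rewrite -muleA; apply: lee_wpmul2l; first by rewrite lee_fin.
rewrite SE.
(* S may be infinite.  With 0 * +oo = 0 the inequality then says that the left-hand
   side vanishes with Sigma, which holds since all terms of Sigma do. *)
have [Sy|Sny] := eqVneq S +oo%E; last first.
  have Sfin : S \is a fin_num by rewrite ge0_fin_numE// lt_neqAle Sny leey.
  rewrite -(fineK Sfin) muleC; under eq_eseriesr do rewrite muleC.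
  by rewrite nneseriesZl.
have [s0|sn0] := eqVneq (\sum_(0 <= k <oo) c k)%E 0%E; last first.
  rewrite Sy gt0_muley ?leey// lt_def sn0; exact: nneseries_ge0.
rewrite s0 mul0e.
have ck0 k : c k = 0%E.
  apply/eqP; rewrite eq_le c0 andbT -s0 (nneseriesD1 (n := k))//.
  by rewrite leeDl//; apply: nneseries_ge0.
by rewrite eseries0// => k _ _; rewrite ck0 mul0e.
Qed.

End SigmaBound.

(** * Transfer of almost periodicity *)

Section Transfer.
Variable R : realType.
Implicit Types (p : R -> \bar R) (u : R -> R).

(** The admissible scale may vary with the interval; for finitely many intervals
    the smallest scale works for all of them. *)
Lemma varphi_int_lty_cover p u (t0 l : R) : exponent p -> 0 < l ->
  (forall x, 0 <= u x) -> leb_measurable setT (fun x => (u x)%:E) ->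
  (forall t, exists2 lam : R, 0 < lam &
    (leb_int `[t, (t + l)%R] (fun x => varphi (p x) (u x / lam)%:E) <= 1)%E) ->
  forall N : nat, exists2 lam : R, 0 < lam &
    (leb_int `[t0, (t0 + N%:R * l)%R[ (fun x => varphi (p x) (lam * u x)%:E) < +oo)%E.
Proof.
move=> ep l0 u0 mu_ small; elim=> [|N [lam lam0 IH]].
  exists 1 => //; rewrite mul0r addr0 (_ : `[t0, t0[%classic = set0).
    by rewrite /leb_int integral_set0.
  by apply/seteqP; split=> x //=; rewrite in_itv/=; lra.
have [al al0 hal] := small (t0 + N%:R * l).
pose be := Num.min lam al^-1.
have be0 : 0 < be by rewrite lt_min lam0 invr_gt0.
exists be; first exact: be0.
have mphi (c : R) (D : set R) : leb_measurable_set D ->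
    leb_measurable D (fun x => varphi (p x) (c * u x)%:E).
  move=> mD; apply: varphi_measurable => //.
  apply/measurable_EFinP; apply: measurable_funM; first exact: measurable_cst.
  by apply/measurable_EFinP; exact: (leb_measurableS measurableT (@subsetT _ _) mu_).
have mono (c d : R) (D : set R) : 0 < c -> c <= d ->
    (leb_int D (fun x => varphi (p x) (c * u x)%:E) <=
     leb_int D (fun x => varphi (p x) (d * u x)%:E))%E.
  move=> c0 cd; apply: leb_int_mono => x _; first exact: varphi_ge0.
  apply: varphi_mono; [exact: ep.2| |].
    by rewrite lee_fin; apply: mulr_ge0; [exact: ltW|exact: u0].
  by rewrite lee_fin; apply: ler_wpM2r; [exact: u0|].
set t1 := t0 + N%:R * l in hal IH *.
have t2E : t0 + N.+1%:R * l = t1 + l by rewrite /t1 mulrS; ring.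
have t01 : t0 <= t1 by rewrite lerDl; apply: mulr_ge0 => //; exact: ltW.
have -> : `[t0, (t0 + N.+1%:R * l)[%classic = `[t0, t1[ `|` `[t1, (t1 + l)[.
  rewrite t2E; apply/seteqP; split=> x /=; rewrite !in_itv/=.
    by move=> /andP[h1 h2]; have [h3|h3] := ltP x t1; [left|right]; rewrite ?h1 ?h2.
  by case=> /andP[h1 h2]; apply/andP; split; lra.
rewrite /leb_int (@ge0_integral_setU _ (lebesgueR R) R (leb R)).
- apply: lte_add_pinfty.
    by apply: le_lt_trans IH; apply: mono => //; rewrite ge_min lexx.
  apply: (@le_lt_trans _ _ 1%E); last exact: ltry.
  apply: le_trans hal; apply: (@le_trans _ _ (leb_int `[t1, t1 + l] (fun x => varphi (p x) (be * u x)%:E))).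
    apply: leb_int_subset => [x _|]; first exact: varphi_ge0.
    exact: subset_itv_co_cc.
  under [X in (_ <= leb_int _ X)%E]eq_fun do rewrite mulrC.
  by apply: mono => //; rewrite ge_min lexx orbT.
- exact: leb_measurable_itv.
- exact: leb_measurable_itv.
- by apply: mphi; apply: measurableU; exact: leb_measurable_itv.
- by move=> x _; exact: varphi_ge0.
- apply/disj_setPS => x [] /=; rewrite !in_itv/= => /andP[_ h1] /andP[h2 _]; lra.
Qed.

(** A compact set is covered by finitely many intervals of length l, so uniform
    control of the norms on these intervals gives local membership in the
    Lebesgue space. *)
Lemma in_Lp_compact p u (l : R) : exponent p -> 0 < l ->
  (forall x, 0 <= u x) -> leb_measurable setT (fun x => (u x)%:E) ->
  (forall t, exists2 lam : R, 0 < lam &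
    (leb_int `[t, (t + l)%R] (fun x => varphi (p x) (u x / lam)%:E) <= 1)%E) ->
  forall K : set R, compact K -> in_Lp p K u.
Proof.
move=> ep l0 u0 mu_ small K cK.
have mK : leb_measurable_set K by apply: leb_measurable_borel; exact: compact_measurable.
split; first exact: (leb_measurableS measurableT (@subsetT _ _) mu_).
have [M [_ /(_ (M + 1)) KM]] := @compact_bounded R R^o K cK.
have {}KM x : K x -> `|x| <= M + 1 by apply: KM; rewrite ltrDl.
have [M0|Mneg] := leP 0 (M + 1); last first.
  exists 1 => //; rewrite (_ : K = set0); first by rewrite /leb_int integral_set0.
  apply/seteqP; split=> x // /KM h; have := normr_ge0 x; lra.
(* M + 2 exceeds the bound M + 1 of K: the covering intervals are half-open. *)
pose N := Num.bound (2 * (M + 2) / l).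
have hN : 2 * (M + 2) < N%:R * l.
  rewrite -ltr_pdivrMr//; apply: archi_boundP; apply: divr_ge0; [lra|exact: ltW].
have [lam lam0 h] := varphi_int_lty_cover (- (M + 2)) ep l0 u0 mu_ small N.
exists lam => //; apply: le_lt_trans h; apply: leb_int_subset => [x _|x /KM].
  exact: varphi_ge0.
rewrite ler_norml /= in_itv/= => /andP[h1 h2]; apply/andP; split; lra.
Qed.

End Transfer.

Section Core.
Variables (R : realType) (X Y : completeNormedModType R[i]).
Variables (T : R -> {linear X -> Y}) (g : R -> X).
Variables (phi : R -> R) (F F1 : R -> R -> R) (p q : R -> \bar R).
Hypothesis phi_ge0 : forall y : R, 0 <= y -> 0 <= phi y.
Hypothesis F_gt0 : forall l t : R, 0 < l -> 0 < F l t.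
Hypothesis F1_gt0 : forall l t : R, 0 < l -> 0 < F1 l t.
Hypothesis p_exp : exponent p.
Hypothesis q_exp : exponent q.
Hypothesis pq : forall x : R, ((p x)^-1 + (q x)^-1 = 1)%E.
Hypothesis T_sc : strongly_continuous T.
Hypothesis rg_meas : strongly_measurable setT (reflect_fun g).
Hypothesis Trg_int : forall x : R,
  (leb_int `](- x)%R, +oo[
    (fun v => (opnorm (T (v + x)) * rnorm (reflect_fun g v))%R%:E) < +oo)%E.
Hypothesis Sigma_lty : forall l x : R, 0 < l -> (Sigma T q F l x < +oo)%E.

Lemma Weyl_sup_leP (V : completeNormedModType R[i]) (f : R -> V) (H : R -> R -> R) tau l eps :
  (Weyl_sup p phi H f tau l <= eps%:E)%E <->
  forall t, phi (H l t * fine (Lp_norm p `[t, t + l] (diff_norm f tau))) <= eps.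
Proof.
split=> [h t|h]; last by apply: ge_ereal_sup => _ [t _ <-]; rewrite lee_fin.
by rewrite -lee_fin; apply: le_trans h; apply: ereal_sup_ubound; exists t.
Qed.

(** The heart of the proof. The pointwise bound by Sigma and the integral
    inequality in the hypothesis give a Luxemburg norm at most lam <= a, and the
    inclusion in the hypothesis says exactly that phi maps such norms, weighted
    by F1, to values at most eps. *)
Lemma convolution_transfer (tau l eps : R) : 0 < l ->
  (forall t, Weyl_condition T p q phi F F1 t l eps) ->
  diff_Lploc p (reflect_fun g) (- tau) ->
  (Weyl_sup p phi F (reflect_fun g) (- tau) l <= eps%:E)%E ->
  diff_Lploc p (convolution T g) tau /\
  (Weyl_sup p phi F1 (convolution T g) tau l <= eps%:E)%E.
Proof.
move=> l0 cond du /Weyl_sup_leP gsup.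
set u := diff_norm (convolution T g) tau.
have u0 x : 0 <= u x by exact: rnorm_ge0.
have mu_ : leb_measurable setT (fun x => (u x)%:E).
  apply: convolution_diff_measurable => //; first exact: strongly_measurable_unreflect.
  exact: convolution_weight_lty.
pose S := ereal_sup [set y%:E | y in phi_preimage phi eps].
have ule x : ((u x)%:E <= 2%:E * Sigma T q F l x * S)%E.
  apply: (convolution_diff_le_Sigma T_sc rg_meas Trg_int F_gt0 p_exp q_exp pq l0 (Sigma_lty x l0) du).
  move=> t; apply: ereal_sup_ubound.
  have nn : 0 <= F l t * fine (Lp_norm p `[t, t + l] (diff_norm (reflect_fun g) (- tau))).
    by apply: mulr_ge0; [rewrite ltW// F_gt0|apply: fine_ge0; exact: Lp_norm_ge0].
  exists (F l t * fine (Lp_norm p `[t, t + l] (diff_norm (reflect_fun g) (- tau)))) => //.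
  by split=> //; rewrite phi_ge0//=; exact: gsup.
have int_le t a lam : 0 < lam -> (leb_int `[t, (t + l)%R] (fun x => varphi (p x)
      (2%:E * Sigma T q F l x * S * (lam^-1)%:E)) <= a)%E ->
    (leb_int `[t, (t + l)%R] (fun x => varphi (p x) (u x / lam)%:E) <= a)%E.
  move=> lam0; apply: le_trans; apply: leb_int_mono => x _; first exact: varphi_ge0.
  apply: varphi_mono; [exact: p_exp.2| |].
    by rewrite lee_fin; apply: divr_ge0; [exact: u0|exact: ltW].
  rewrite EFinM; apply: lee_wpmul2r; last exact: ule.
  by rewrite lee_fin invr_ge0 ltW.
split.
  apply: (in_Lp_compact p_exp l0 u0 mu_) => t.
  by have [a [lam [_ lam0 _ _ h]]] := cond t; exists lam => //; exact: int_le h.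
apply/Weyl_sup_leP => t; have [a [lam [a0 lam0 lama sub h]]] := cond t.
have Nlam : (Lp_norm p `[t, (t + l)%R] u <= lam%:E)%E.
  by apply: Lp_norm_le => //; exact: int_le h.
have N0 := Lp_norm_ge0 p `[t, t + l] u.
rewrite -/u; move: Nlam N0; case: (Lp_norm _ _ _) => [r||//]; last by rewrite leye_eq.
rewrite !lee_fin /= => rlam r0.
have [|z [z0 /andP[_ phiz]] zr] := sub r.
  by rewrite /= in_itv/= r0 (le_trans rlam lama).
by rewrite -zr mulVKf ?gt_eqF ?F1_gt0.
Qed.

(** Reflecting an interval about 0 exchanges its end points. A closed end stays
    closed, which negates the booleans because they mean opposite things at the
    two ends. *)
Lemma meets_intervals_opp (L : R) (P Q : R -> Prop) :
  (forall tau, P (- tau) -> Q tau) ->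
  meets_intervals_of_length L P -> meets_intervals_of_length L Q.
Proof.
move=> PQ mP b b' a.
have [s sI Ps] := mP (~~ b') (~~ b) (- (a + L)).
exists (- s); last by apply: PQ; rewrite opprK.
by rewrite oppr_itv; move: sI; rewrite opprD subrK.
Qed.

End Core.

Theorem theorem4p9 (R : realType) (X Y : completeNormedModType R[i])
    (phi : R -> R) (F F1 : R -> R -> R) (p q : R -> \bar R)
    (T : R -> {linear X -> Y}) (g : R -> X)
    (phi_ge0 : forall y : R, 0 <= y -> 0 <= phi y)
    (F_gt0 : forall l t : R, 0 < l -> 0 < F l t)
    (F1_gt0 : forall l t : R, 0 < l -> 0 < F1 l t)
    (p_exponent : exponent p) (q_exponent : exponent q)
    (pq_conjugate : forall x : R, ((p x)^-1 + (q x)^-1 = 1)%E)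
    (T_strongly_continuous : strongly_continuous T)
    (g_measurable : strongly_measurable setT (reflect_fun g))
    (Tg_integrable : forall x : R,
      (leb_int `](- x)%R, +oo[
        (fun v => (opnorm (T (v + x)) * rnorm (reflect_fun g v))%R%:E) < +oo)%E)
    (Sigma_lty : forall l x : R, 0 < l -> (Sigma T q F l x < +oo)%E)
    (g_Lploc : forall tau : R, diff_Lploc p (reflect_fun g) tau) :
  (equi_Weyl_ap p phi F (reflect_fun g) ->
   (forall t l eps : R, 0 < l -> 0 < eps ->
     Weyl_condition T p q phi F F1 t l eps) ->
   convolution_integrable T g /\ equi_Weyl_ap p phi F1 (convolution T g))
  /\
  (Weyl_ap p phi F (reflect_fun g) ->
   (exists2 l0 : R, 0 < l0 &
     forall t l eps : R, l0 <= l -> 0 < eps ->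
       Weyl_condition T p q phi F F1 t l eps) ->
   convolution_integrable T g /\ Weyl_ap p phi F1 (convolution T g)).
Proof.
have Gint : convolution_integrable T g by exact: convolution_integrable_of_reflected.
have transfer := convolution_transfer phi_ge0 F_gt0 F1_gt0 p_exponent q_exponent
  pq_conjugate T_strongly_continuous g_measurable Tg_integrable Sigma_lty.
split=> [gap cond|gap [l0 l00 cond]]; (split; first exact: Gint) => eps eps0.
  have [l [L [l_gt0 L_gt0 meets]]] := gap eps eps0.
  exists l, L; split; [exact: l_gt0|exact: L_gt0|].
  apply: meets_intervals_opp meets => tau [du gsup].
  exact: (transfer _ _ _ l_gt0 (fun t => cond t l eps l_gt0 eps0) du gsup).
have eps20 : 0 < eps / 2 by rewrite divr_gt0.
have [L L_gt0 meets] := gap (eps / 2) eps20.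
exists L; first exact: L_gt0.
apply: meets_intervals_opp meets => tau [du glim].
have : (limf_esup (Weyl_sup p phi F (reflect_fun g) (- tau)) (pinfty_nbhs R) < eps%:E)%E.
  apply: le_lt_trans glim _; rewrite lte_fin; lra.
move=> /ereal_inf_lt[_ [V [M [_ MV]] <-] Vlt].
have good l : M < l -> l0 <= l -> diff_Lploc p (convolution T g) tau /\
    (Weyl_sup p phi F1 (convolution T g) tau l <= eps%:E)%E.
  move=> Ml l0l; have l_gt0 : 0 < l by exact: lt_le_trans l0l.
  apply: (transfer _ _ _ l_gt0 (fun t => cond t l eps l0l eps0) du).
  apply: le_trans (ltW Vlt); apply: ereal_sup_ubound.
  by exists l; first exact: MV.
pose m := Num.max M l0 + 1.
have Mm : M < m by rewrite ltr_pwDr// le_max lexx.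
have l0m : l0 <= m by rewrite ler_wpDr// le_max lexx orbT.
split; first exact: (good m Mm l0m).1.
apply: (@le_trans _ _ (ereal_sup (Weyl_sup p phi F1 (convolution T g) tau @` [set l | m < l]))).
  apply: ereal_inf_lbound; exists [set l | m < l].
    by exists m; split; [exact: num_real|].
  by [].
apply: ge_ereal_sup => _ [l /= ml <-].
exact: (good l (lt_trans Mm ml) (le_trans l0m (ltW ml))).2.
Qed.
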